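(* For all positive integers $m,n$, the algebra $A_{m,n}$ is finitely based if and only if $m\le 2$ or $(m,n)=(3,1)$. Finite bases in all the positive cases are as follows. (i) For every $n\ge 1$, a basis for $A_{1,n}$ is $\mathbf A\cup\{xy\approx zt,\ x+yz\approx yz\}$. (ii) For every $n\ge1$, a basis for $A_{2,n}$ is $\mathcal B$ together with: the identity $xy\approx x^2+y^2$ if $n=1$; the identity $x^2+yz\approx x^2+yz+y^2$ if $n=2$; the identity $(x+y)^2\approx x^2+y^2$ if $n\ge3$ is odd; no additional identity if $n\ge4$ is even. (iii) A basis for $A_{3,1}$ is $\mathbf A\cup\mathbf F$ together with the seven identities $$xy\approx yx,\quad x_1x_2x_3x_4\approx y_1y_2y_3y_4,\quad (x+y)^2\approx x^2+y^2,\quad (x+y)^3\approx x^3+y^3,$$ $$x^2+yz\approx x^2+yz+y^2,\quad x^2+y^3\approx x^4,\quad xyz\approx xyz+x^3.$$ In every other case (that is, $m\ge3$ and $(m,n)\ne(3,1)$) and for every integer $r\ge1$, there exists a finite ai-semiring satisfying all identities of $A_{m,n}$ in at most $r$ variables but not belonging to $\mathcal V(A_{m,n})$.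
   Context: The signature consists of two binary operations $(+,\cdot)$, with no constants. For positive integers $m,n$, let $A_{m,n}=(\{1,\ldots,m\}\times\mathbb Z_n)\cup\{0\}$, where $\mathbb Z_n=\mathbb Z/n\mathbb Z$ and $0$ is a newly adjoined element. Addition: $s+s=s$, and $s+t=0$ for $s\ne t$. Multiplication: any product with a factor $0$ is $0$, and $(i,g)(j,h)=(i+j,g+h)$ if $i+j\le m$, while $(i,g)(j,h)=0$ if $i+j>m$. $\mathbf A$ denotes the six identities $(x+y)+z\approx x+(y+z)$, $x+y\approx y+x$, $x+x\approx x$, $(xy)z\approx x(yz)$, $x(y+z)\approx xy+xz$, $(x+y)z\approx xz+yz$. An ai-semiring is an algebra in the signature $(+,\cdot)$ satisfying $\mathbf A$. $\mathbf F$ denotes the sixteen identities obtained from $$x_1ux_2+y_1uy_2+y_1vy_2\approx x_1vx_2+y_1uy_2+y_1vy_2$$ by independently retaining or omitting each of the variables $x_1,x_2,y_1,y_2$ (an omitted variable is simply deleted throughout from the products). $\mathcal B=\mathbf A\cup\mathbf F\cup\{xy\approx yx,\ x_1x_2x_3\approx y_1y_2y_3\}$. $\mathcal V(S)$ denotes the variety generated by $S$. A set $\Sigma$ of identities is a basis for $S$ if the models of $\Sigma$ are exactly the members of $\mathcal V(S)$ (equivalently, the identities of $S$ are exactly the equational consequences of $\Sigma$). $S$ is finitely based if it has a finite basis. *)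

(* Defs.v *)
From Stdlib Require Import ClassicalEpsilon.
From mathcomp Require Import all_boot all_algebra.

Set Implicit Arguments.
Unset Strict Implicit.
Unset Printing Implicit Defensive.

Record algebra := Algebra {
  carrier :> Type;
  alg_add : carrier -> carrier -> carrier;
  alg_mul : carrier -> carrier -> carrier;
  alg_nonempty : inhabited carrier }.

Definition hom (A B : algebra) (f : A -> B) : Prop :=
  {morph f : s t / alg_add s t} /\ {morph f : s t / alg_mul s t}.

Definition product (I : Type) (A : I -> algebra) : algebra :=
  @Algebra (forall i, A i)
    (fun s t i => alg_add (s i) (t i))
    (fun s t i => alg_mul (s i) (t i))
    (inhabits (fun i => epsilon (alg_nonempty (A i)) (fun=> True))).

Definition variety (K : algebra -> Prop) : Prop :=
  [/\ forall (A B : algebra) (f : A -> B),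
        hom f -> (forall b, exists a, f a = b) -> K A -> K B,
      forall (A B : algebra) (f : A -> B),
        hom f -> injective f -> K B -> K A
    & forall (I : Type) (A : I -> algebra),
        (forall i, K (A i)) -> K (product A)].

(* B belongs to the variety generated by S. *)
Definition in_variety (S B : algebra) : Prop :=
  forall K : algebra -> Prop, variety K -> K S -> K B.

Definition finite_algebra (A : algebra) : Prop :=
  exists (T : finType) (f : T -> A), bijective f.

Inductive term : Type :=
| Var of nat
| Add of term & term
| Mul of term & term.

Record identity := Identity { lhs : term; rhs : term }.

Declare Scope trm_scope.
Delimit Scope trm_scope with trm.
Notation "s + t" := (Add s t) : trm_scope.
Notation "s * t" := (Mul s t) : trm_scope.
Notation "s ≈ t" := (Identity s t) (at level 70, no associativity) : trm_scope.

Fixpoint vars (t : term) : seq nat :=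
  match t with
  | Var i => [:: i]
  | Add s u | Mul s u => vars s ++ vars u
  end.

Definition nvars (e : identity) : nat :=
  size (undup (vars (lhs e) ++ vars (rhs e))).

Fixpoint eval (A : algebra) (v : nat -> A) (t : term) : A :=
  match t with
  | Var i => v i
  | Add s u => alg_add (eval v s) (eval v u)
  | Mul s u => alg_mul (eval v s) (eval v u)
  end.

Definition satisfies (A : algebra) (e : identity) : Prop :=
  forall v : nat -> A, eval v (lhs e) = eval v (rhs e).

Definition model (E : identity -> Prop) (A : algebra) : Prop :=
  forall e, E e -> satisfies A e.

Definition of_seq (s : seq identity) : identity -> Prop :=
  fun e => List.In e s.

Definition basis (E : identity -> Prop) (S : algebra) : Prop :=
  forall B : algebra, model E B <-> in_variety S B.

Definition finitely_based (S : algebra) : Prop :=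
  exists s : seq identity, basis (of_seq s) S.

(* For n >= 1 this is Z/nZ, including n = 1, where 'Z_1 would be Z/2Z. *)
Definition Zmod (n : nat) := 'I_n.-1.+1.

(* None is the adjoined element 0. *)
Definition Acarrier (m n : nat) := option ({i : nat | 0 < i <= m} * Zmod n).

Definition Aadd (m n : nat) (s t : Acarrier m n) : Acarrier m n :=
  if s == t then s else None.

(* insub k is Some of k when 0 < k <= m, and None otherwise. *)
Definition Amul (m n : nat) (s t : Acarrier m n) : Acarrier m n :=
  match s, t with
  | Some (i, g), Some (j, h) =>
      omap (fun k => (k, (g + h)%R)) (insub (sval i + sval j))
  | _, _ => None
  end.

Definition Aalg (m n : nat) : algebra :=
  @Algebra (Acarrier m n) (@Aadd m n) (@Amul m n) (inhabits None).

Definition ids_A : seq identity :=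
  let x := Var 0 in let y := Var 1 in let z := Var 2 in
  [:: (x + y) + z ≈ x + (y + z);
      x + y ≈ y + x;
      x + x ≈ x;
      (x * y) * z ≈ x * (y * z);
      x * (y + z) ≈ x * y + x * z;
      (x + y) * z ≈ x * z + y * z]%trm.

Definition ai_semiring (A : algebra) : Prop := model (of_seq ids_A) A.

(* The product l w r, where l (resp. r) is deleted if p.1 (resp. p.2) is
   false. *)
Definition frame (p : bool * bool) (l w r : term) : term :=
  let lw := if p.1 then Mul l w else w in
  if p.2 then Mul lw r else lw.

Definition id_F (p q : bool * bool) : identity :=
  let x1 := Var 0 in let x2 := Var 1 in
  let y1 := Var 2 in let y2 := Var 3 in
  let u := Var 4 in let v := Var 5 in
  (frame p x1 u x2 + frame q y1 u y2 + frame q y1 v y2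
     ≈ frame p x1 v x2 + frame q y1 u y2 + frame q y1 v y2)%trm.

Definition ids_F : seq identity :=
  let bb := [:: (true, true); (true, false); (false, true); (false, false)] in
  [seq id_F p q | p <- bb, q <- bb].

Definition ids_B : seq identity :=
  let x := Var 0 in let y := Var 1 in
  let x1 := Var 0 in let x2 := Var 1 in let x3 := Var 2 in
  let y1 := Var 3 in let y2 := Var 4 in let y3 := Var 5 in
  ids_A ++ ids_F ++
  [:: x * y ≈ y * x;
      x1 * x2 * x3 ≈ y1 * y2 * y3]%trm.

Definition basis1 : seq identity :=
  let x := Var 0 in let y := Var 1 in let z := Var 2 in let t := Var 3 in
  ids_A ++
  [:: x * y ≈ z * t;
      x + y * z ≈ y * z]%trm.

Definition basis2 (n : nat) : seq identity :=
  let x := Var 0 in let y := Var 1 in let z := Var 2 in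
  ids_B ++
  (if n == 1 then [:: x * y ≈ x * x + y * y]%trm
   else if n == 2 then [:: x * x + y * z ≈ x * x + y * z + y * y]%trm
   else if odd n then [:: (x + y) * (x + y) ≈ x * x + y * y]%trm
   else [::]).

Definition basis3 : seq identity :=
  let x := Var 0 in let y := Var 1 in let z := Var 2 in
  let x1 := Var 0 in let x2 := Var 1 in let x3 := Var 2 in let x4 := Var 3 in
  let y1 := Var 4 in let y2 := Var 5 in let y3 := Var 6 in let y4 := Var 7 in
  ids_A ++ ids_F ++
  [:: x * y ≈ y * x;
      x1 * x2 * x3 * x4 ≈ y1 * y2 * y3 * y4;
      (x + y) * (x + y) ≈ x * x + y * y;
      (x + y) * (x + y) * (x + y) ≈ x * x * x + y * y * y;
      x * x + y * z ≈ x * x + y * z + y * y;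
      x * x + y * y * y ≈ x * x * x * x;
      x * y * z ≈ x * y * z + x * x * x]%trm.

(* Main.v *)
Require Import Defs.
From Stdlib Require Import ClassicalEpsilon.
From mathcomp Require Import all_boot all_algebra zify boolp.

(** By Birkhoff's theorem, a set of identities true in A_{m,n} is a basis as soon
    as each of its models [B] satisfies all identities of A_{m,n}.  Ordered by
    x <= y iff x + y = y, an ai-semiring gives to a term the least upper bound of
    its words.  If an identity of A_{m,n} failed in [B], some word w of one side
    would therefore not lie below the value b of the other side.  Now A_{m,n} is
    flat: a sum is nonzero only when all its summands are equal.  Thus the
    identity would be refuted in A_{m,n} by any map assigning to the elements of
    [B] a positive degree and an element of Z_n such that the words below b all
    have the same total degree k <= m and the same sum h in Z_n, while w has not
    ([satisfies_of_separated]).  So each word below b is an equation, and the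
    question is whether these equations have a solution violating the equation of
    one further word.

    In the positive cases almost all equations concern pairs of letters.  The
    identities F say that in the relation [xy <= b] any path of length three has
    a chord, so that a connected component is either complete with loops or
    complete bipartite without loops; the equations g(x) + g(y) = h can then be
    solved component by component, and the identities added to F govern how
    components with loops interact, according to the parity of n ([grading]).
    For A_{3,1}, cubes below b fix the degrees of some letters, and the remaining
    letters are coloured with the degrees one and two ([basis3_separated]).

    If m >= 4, or if m = 3 and n > 1, the equations given by products of three
    letters admit as solutions all 0-1 labellings with sum one on each product,
    and such equations can have consequences that no bounded number of unknowns
    can witness.  For N odd, a Moebius ladder yields 2N triples
    of points such that the alternating sum of all triples vanishes; hence the
    equations of 2N - 1 triples imply that of the last one, which is an identity
    of every A_{m,n} ([A_ladder]).  It fails in the finite flat semiring whose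
    nonzero products of three points are the 2N - 1 triples.  Yet fewer than
    N points leave one rung of the ladder free, and a ladder cut at a rung has
    solutions with values 0 and 1 that violate any given equation in three points
    other than those of the triples ([good_separates_triple]).  So this semiring
    satisfies the identities of A_{m,n} in few variables ([ladder_identities]). *)

Set Implicit Arguments.
Unset Strict Implicit.
Unset Printing Implicit Defensive.

Notation "x ⊕ y" := (alg_add x y) (at level 50, left associativity).
Notation "x ⊗ y" := (alg_mul x y) (at level 40, left associativity).

(** * Varieties are the classes defined by identities *)

Lemma hom_eval (A B : algebra) (f : A -> B) (v : nat -> A) (t : term) :
  Defs.hom f -> f (eval v t) = eval (fun i => f (v i)) t.
Proof. by case=> fD fM; elim: t => //= [s <- u <-|s <- u <-]. Qed.

Lemma eval_ext (A : algebra) (v w : nat -> A) (t : term) :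
  (forall i, i \in vars t -> v i = w i) -> eval v t = eval w t.
Proof.
elim: t => /= [i e|s IHs u IHu e|s IHs u IHu e].
- by apply: e; rewrite inE.
- by rewrite IHs ?IHu // => i si; apply: e; rewrite mem_cat si ?orbT.
- by rewrite IHs ?IHu // => i si; apply: e; rewrite mem_cat si ?orbT.
Qed.

Lemma model_variety (E : identity -> Prop) : variety (model E).
Proof.
split=> [A B f fh fs mA|A B f fh fi mB|I A mA] e Ee v.
- pose u i := sval (cid (fs (v i))).
  have uv i : v i = f (u i).
    by rewrite /u; case: (cid _).
  have -> : v = fun i => f (u i) by apply/funext.
  by rewrite -!hom_eval // (mA e Ee).
- by apply: fi; rewrite !hom_eval // (mB e Ee).
- apply: functional_extensionality_dep => i.
  have proj_hom : @Defs.hom (product A) (A i) (fun p => p i) by [].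
  by rewrite !(hom_eval _ _ proj_hom) (mA i e Ee).
Qed.

Lemma in_variety_satisfies (S B : algebra) (e : identity) :
  in_variety S B -> satisfies S e -> satisfies B e.
Proof.
by move=> SB Se; apply: (SB _ (model_variety (fun e' => e' = e))) => // _ ->.
Qed.

Fixpoint rename (r : nat -> nat) (t : term) : term :=
  match t with
  | Var i => Var (r i)
  | Add s u => Add (rename r s) (rename r u)
  | Mul s u => Mul (rename r s) (rename r u)
  end.

Lemma eval_rename (A : algebra) (v : nat -> A) (r : nat -> nat) (t : term) :
  eval v (rename r t) = eval (fun i => v (r i)) t.
Proof. by elim: t => //= [s -> u ->|s -> u ->]. Qed.

Section Birkhoff.
Variables (S B : algebra).
Hypothesis SB : forall e, satisfies S e -> satisfies B e.

(** The free algebra of the variety on the set [B], realised inside the power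
    of [S] indexed by the valuations [B -> S]. *)
Let power := product (fun _ : B -> S => S).

Let term_function (p : power) : Prop :=
  exists (t : term) (l : nat -> B), forall f, p f = eval (fun i => f (l i)) t.

(** Two assignments of elements of [B] to the variables are put side by side, on
    the even and on the odd variables. *)
Let joined (l l' : nat -> B) (i : nat) : B :=
  if odd i then l' i./2 else l i./2.

Let eval_joined_l (A : algebra) (f : B -> A) l l' t :
  eval (fun i => f (joined l l' i)) (rename double t)
    = eval (fun i => f (l i)) t.
Proof.
by rewrite eval_rename; apply: eval_ext => i _; rewrite /joined odd_double doubleK.
Qed.

Let eval_joined_r (A : algebra) (f : B -> A) l l' t :
  eval (fun i => f (joined l l' i)) (rename (fun i => i.*2.+1) t)
    = eval (fun i => f (l' i)) t.
Proof.
rewrite eval_rename; apply: eval_ext => i _.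
by rewrite /joined /= odd_double /= uphalf_double.
Qed.

Let term_function_op (p q : power) (o : bool) :
  term_function p -> term_function q ->
  term_function (if o then p ⊕ q else p ⊗ q).
Proof.
move=> [t [l tl]] [t' [l' tl']].
exists ((if o then Add else Mul) (rename double t) (rename (fun i => i.*2.+1) t')).
exists (joined l l') => f.
by case: o => /=; rewrite eval_joined_l eval_joined_r tl tl'.
Qed.

(** Two terms over [B] that define the same function on [B -> S] have the same
    value in [B].  The variables carrying the same element of [B] are first
    merged into one: a valuation of the merged variables then factors through
    [B], so that the equality of functions becomes an identity of [S]. *)
Let term_function_inj (t t' : term) (l l' : nat -> B) :
  (forall f : B -> S, eval (fun i => f (l i)) t = eval (fun i => f (l' i)) t') ->
  eval l t = eval l' t'.
Proof.
move=> tt'; pose L := joined l l'.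
pose r i := epsilon (inhabits 0) (fun k => L k = L i).
have Lr i : L (r i) = L i.
  by apply: (epsilon_spec (inhabits 0) (fun k => L k = L i)); exists i.
pose t1 := rename r (rename double t).
pose t2 := rename r (rename (fun i => i.*2.+1) t').
have S12 : satisfies S (Identity t1 t2).
  move=> v.
  pose f b := v (epsilon (inhabits 0) (fun k => L k = b)).
  have := tt' f; rewrite -(eval_joined_l f l l') -(eval_joined_r f l l').
  by rewrite /= !eval_rename.
have := SB S12 L; rewrite /= /t1 /t2.
have EL u : eval L (rename r u) = eval L u.
  by rewrite eval_rename; apply: eval_ext => i _; rewrite Lr.
by rewrite !EL (eval_joined_l id) (eval_joined_r id).
Qed.

Let sub_nonempty : inhabited {p : power | term_function p}.
Proof.
case: (alg_nonempty B) => b; constructor.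
by exists (fun f => f b), (Var 0), (fun=> b).
Qed.

Let sub : algebra :=
  @Algebra {p : power | term_function p}
    (fun p q => exist _ _ (term_function_op true (svalP p) (svalP q)))
    (fun p q => exist _ _ (term_function_op false (svalP p) (svalP q)))
    sub_nonempty.

Let sub_value (p : sub) : B :=
  let (t, tl) := cid (svalP p) in
  let (l, _) := cid tl in eval l t.

Let sub_valueE (p : sub) t l :
  (forall f, sval p f = eval (fun i => f (l i)) t) -> sub_value p = eval l t.
Proof.
move=> pE; rewrite /sub_value.
case: (cid _) => t' tl'.
case: (cid _) => l' pE'.
by apply: term_function_inj => f; rewrite -pE -pE'.
Qed.

(** Birkhoff's theorem: an algebra that satisfies the identities of [S] is a
    quotient of a subalgebra of a power of [S]. *)
Theorem birkhoff : in_variety S B.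
Proof.
move=> K [KH KS KP] K_S.
apply: (KH sub B sub_value).
- have op_hom o : {morph sub_value : p q / if o then p ⊕ q else p ⊗ q}.
    move=> [p [t [l pE]]] [q [t' [l' qE]]].
    rewrite (sub_valueE (p := exist _ p _) pE) (sub_valueE (p := exist _ q _) qE).
    rewrite -(eval_joined_l id l l') -(eval_joined_r id l l').
    rewrite (sub_valueE (l := joined l l') (t := (if o then Add else Mul)
       (rename double t) (rename (fun i => i.*2.+1) t'))) /=; first by case: o.
    by move=> f; case: o => /=; rewrite eval_joined_l eval_joined_r pE qE.
  by split=> p q; [apply: (op_hom true)|apply: (op_hom false)].
- move=> b.
  have bP : term_function (fun f => f b) by exists (Var 0), (fun=> b).
  by exists (exist _ _ bP); rewrite (@sub_valueE _ (Var 0) (fun=> b)).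
- apply: (KS sub power sval) => //; last exact: KP.
  move=> [p pP] [q qP] /= pq; case: _ / pq qP => qP.
  by congr (exist _ _ _); apply: Prop_irrelevance.
Qed.

End Birkhoff.

Lemma basis_completeness (E : identity -> Prop) (S : algebra) :
  model E S ->
  (forall B e, model E B -> satisfies S e -> satisfies B e) -> basis E S.
Proof.
move=> ES EB B; split=> [mB|SB e Ee].
  by apply: birkhoff => e; apply: EB.
by apply: in_variety_satisfies SB _; apply: ES.
Qed.

(** * The order of an ai-semiring, and terms as sets of words *)

Definition le (A : algebra) (x y : A) : Prop := x ⊕ y = y.
Notation "x ⊑ y" := (le x y) (at level 70, no associativity).

Definition additive (A : algebra) (f : A -> A) : Prop :=
  {morph f : x y / x ⊕ y}.

(** A nonempty word, given by its first letter and the sequence of the others;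
    the signature has no constant, so that the empty word has no value. *)
Definition word (X : Type) : Type := (X * seq X)%type.

Definition letters (X : Type) (w : word X) : seq X := w.1 :: w.2.

Definition wmap (X Y : Type) (f : X -> Y) (w : word X) : word Y :=
  (f w.1, map f w.2).

Definition wcat (X : Type) (u w : word X) : word X := (u.1, u.2 ++ letters w).

Definition wprod (A : algebra) (w : word A) : A :=
  foldl (@alg_mul A) w.1 w.2.

Fixpoint words (t : term) : seq (word nat) :=
  match t with
  | Var i => [:: (i, [::])]
  | Add s u => words s ++ words u
  | Mul s u => [seq wcat w w' | w <- words s, w' <- words u]
  end.

Lemma letters_words (t : term) (w : word nat) :
  w \in words t -> {subset letters w <= vars t}.
Proof.
elim: t w => /= [i|s IHs u IHu|s IHs u IHu] w.
- by rewrite inE => /eqP ->.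
- rewrite mem_cat => /orP[/IHs|/IHu] sw i /sw; rewrite mem_cat => ->//.
  by rewrite orbT.
- case/allpairsP=> -[w1 w2] /= [/IHs s1 /IHu s2 ->] i.
  by rewrite /letters /= -cat_cons !mem_cat => /orP[/s1|/s2] ->; rewrite ?orbT.
Qed.

Lemma words_neq_nil (t : term) : exists w, w \in words t.
Proof.
elim: t => /= [i|s [w sw] u _|s [w sw] u [w' sw']].
- by exists (i, [::]); rewrite inE.
- by exists w; rewrite mem_cat sw.
- by exists (wcat w w'); apply/allpairsP; exists (w, w').
Qed.

Lemma model_nth (A : algebra) (E : seq identity) (k : nat) :
  model (of_seq E) A -> k < size E ->
  satisfies A (nth (Identity (Var 0) (Var 0)) E k).
Proof.
move=> mA kE; apply: mA; elim: E k kE => [|e E IH] [|k] //= kE; first by left.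
by right; apply: IH.
Qed.

Section AiSemiring.
Variable A : algebra.
Hypothesis A_ai : ai_semiring A.
Implicit Types x y z b : A.

Let ai_id k x y z :
  k < 6 -> let e := nth (Identity (Var 0) (Var 0)) ids_A k in
  eval (nth z [:: x; y]) (lhs e) = eval (nth z [:: x; y]) (rhs e).
Proof. by move=> k6 e; apply: (@model_nth A ids_A). Qed.

Lemma aiA x y z : x ⊕ y ⊕ z = x ⊕ (y ⊕ z).
Proof. exact: (@ai_id 0 x y z). Qed.

Lemma aiC x y : x ⊕ y = y ⊕ x.
Proof. exact: (@ai_id 1 x y y). Qed.

Lemma aixx x : x ⊕ x = x.
Proof. exact: (@ai_id 2 x x x). Qed.

Lemma ai_mulA x y z : x ⊗ y ⊗ z = x ⊗ (y ⊗ z).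
Proof. exact: (@ai_id 3 x y z). Qed.

Lemma ai_mulDr x y z : x ⊗ (y ⊕ z) = x ⊗ y ⊕ x ⊗ z.
Proof. exact: (@ai_id 4 x y z). Qed.

Lemma ai_mulDl x y z : (x ⊕ y) ⊗ z = x ⊗ z ⊕ y ⊗ z.
Proof. exact: (@ai_id 5 x y z). Qed.

Lemma le_refl x : x ⊑ x. Proof. exact: aixx. Qed.

Lemma le_anti x y : x ⊑ y -> y ⊑ x -> x = y.
Proof. by rewrite /le aiC => xy <-. Qed.

Lemma le_trans y x z : x ⊑ y -> y ⊑ z -> x ⊑ z.
Proof. by rewrite /le => xy <-; rewrite -aiA xy. Qed.

Lemma le_addl x y : x ⊑ x ⊕ y.
Proof. by rewrite /le -aiA aixx. Qed.

Lemma le_addr x y : y ⊑ x ⊕ y.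
Proof. by rewrite aiC; apply: le_addl. Qed.

Lemma add_le x y b : x ⊑ b -> y ⊑ b -> x ⊕ y ⊑ b.
Proof. by rewrite /le aiA => xb ->. Qed.

Lemma add_leE x y b : x ⊕ y ⊑ b <-> x ⊑ b /\ y ⊑ b.
Proof.
split=> [xyb|[xb yb]]; last exact: add_le.
by split; apply: le_trans xyb; [apply: le_addl|apply: le_addr].
Qed.

Lemma le_mul x y x' y' : x ⊑ x' -> y ⊑ y' -> x ⊗ y ⊑ x' ⊗ y'.
Proof.
by rewrite /le => <- <-; rewrite ai_mulDl !ai_mulDr !aiA -aiA aixx.
Qed.

Lemma wprod_cat (u w : word A) : wprod (wcat u w) = wprod u ⊗ wprod w.
Proof.
case: u w => [x l] [y l']; rewrite /wprod /= foldl_cat /=.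
elim/last_ind: l' => //= l' z IH.
by rewrite -!cats1 !foldl_cat /= IH ai_mulA.
Qed.

Lemma le_eval (v : nat -> A) (t : term) (w : word nat) :
  w \in words t -> wprod (wmap v w) ⊑ eval v t.
Proof.
elim: t w => /= [i|s IHs u IHu|s IHs u IHu] w.
- by rewrite inE => /eqP ->; apply: le_refl.
- rewrite mem_cat => /orP[/IHs|/IHu] wle; apply: le_trans wle _.
    exact: le_addl.
  exact: le_addr.
- case/allpairsP=> -[w1 w2] /= [/IHs s1 /IHu s2 ->].
  rewrite /wmap /= map_cat /=.
  rewrite (wprod_cat (wmap v w1) (wmap v w2)); exact: le_mul.
Qed.

(** Each product being additive in either factor, a product of sums is bounded
    as soon as the products of words are.  The additive map [f] stands for the
    factors that surround the term. *)
Lemma additive_eval_le (v : nat -> A) (t : term) (f : A -> A) b :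
  additive f -> (forall w, w \in words t -> f (wprod (wmap v w)) ⊑ b) ->
  f (eval v t) ⊑ b.
Proof.
elim: t f => /= [i|s IHs u IHu|s IHs u IHu] f fD fle.
- by apply: (fle (i, [::])); rewrite inE.
- rewrite fD; apply: add_le; [apply: IHs => // w sw|apply: IHu => // w uw];
    by apply: fle; rewrite mem_cat ?sw ?uw ?orbT.
- apply: (IHs (fun x => f (x ⊗ eval v u))) => [x y|w1 sw1].
    by rewrite ai_mulDl fD.
  apply: (IHu (fun x => f (wprod (wmap v w1) ⊗ x))) => [x y|w2 sw2].
    by rewrite ai_mulDr fD.
  rewrite -wprod_cat -[wcat _ _]/(_, _ ++ map v (letters w2)) -map_cat.
  by apply: (fle (wcat w1 w2)); apply/allpairsP; exists (w1, w2).
Qed.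

Lemma eval_le (v : nat -> A) (t : term) b :
  (forall w, w \in words t -> wprod (wmap v w) ⊑ b) -> eval v t ⊑ b.
Proof. exact: (additive_eval_le (f := id)). Qed.

End AiSemiring.

(** * Flat algebras *)

Section Flat.
Variables (T : eqType) (mul : option T -> option T -> option T).
Hypotheses (mulA : associative mul) (mulC : commutative mul).
Hypothesis mulN : forall x, mul None x = None.
Hypothesis mulI : forall x y z, mul x y = mul x z -> mul x y <> None -> y = z.

Definition flat : algebra :=
  @Algebra (option T) (fun s t => if s == t then s else None) mul (inhabits None).

Lemma flat_addE (x y : flat) : x ⊕ y = if x == y :> option T then x else None.
Proof. by []. Qed.

Let flatNl (x : flat) : (None : flat) ⊕ x = None.
Proof. by rewrite flat_addE; case: ifP. Qed.

Let flatNr (x : flat) : x ⊕ (None : flat) = None.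
Proof. by rewrite flat_addE; case: eqP. Qed.

Let flat_id (x : flat) : x ⊕ x = x.
Proof. by rewrite flat_addE eqxx. Qed.

Let flat_neq (x y : flat) : x <> y -> x ⊕ y = None.
Proof. by rewrite flat_addE; case: eqP. Qed.

Let mulDr (x y z : flat) : x ⊗ (y ⊕ z) = x ⊗ y ⊕ x ⊗ z.
Proof.
have [->|/eqP yz] := eqVneq (y : option T) z; first by rewrite !flat_id.
rewrite (flat_neq yz) -[x ⊗ _]/(mul x None) mulC mulN.
have [xyz|/eqP xyz] := eqVneq (mul x y) (mul x z); last exact/esym/flat_neq.
rewrite [x ⊗ z]/= -xyz flat_id; case E: (mul x y) => [k|//].
by case: yz; apply: (mulI xyz); rewrite E.
Qed.

Let addA (x y z : flat) : x ⊕ y ⊕ z = x ⊕ (y ⊕ z).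
Proof.
have [<-|/eqP yz] := eqVneq (y : option T) z.
  rewrite flat_id; have [<-|/eqP xy] := eqVneq (x : option T) y.
    by rewrite !flat_id.
  by rewrite (flat_neq xy) flatNl.
rewrite (flat_neq yz) flatNr; have [->|/eqP xy] := eqVneq (x : option T) y.
  by rewrite flat_id flat_neq.
by rewrite (flat_neq xy) flatNl.
Qed.

Let addC (x y : flat) : x ⊕ y = y ⊕ x.
Proof. by rewrite !flat_addE eq_sym; case: eqP. Qed.

Let flat_mulC (x y : flat) : x ⊗ y = y ⊗ x.
Proof. exact: mulC. Qed.

Lemma flat_ai : ai_semiring flat.
Proof.
move=> e [<-|[<-|[<-|[<-|[<-|[<-|[]]]]]]] v.
- exact: addA.
- exact: addC.
- exact: flat_id.
- exact/esym/mulA.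
- exact: mulDr.
- by rewrite [LHS]flat_mulC /= -/flat [LHS]mulDr ![v 2 ⊗ _]flat_mulC.
Qed.

Lemma flat_le (x y : flat) : x ⊑ y -> y <> None -> x = y.
Proof. by rewrite /le flat_addE; case: eqP => // _ ->. Qed.

Lemma flat_eval (v : nat -> flat) (t : term) (k : flat) :
  k <> None ->
  eval v t = k <-> (forall w, w \in words t -> wprod (wmap v w) = k).
Proof.
move=> k0; split=> [E w tw|tk].
  by rewrite -E in k0 *; apply: flat_le => //; apply: (le_eval flat_ai).
have [w tw] := words_neq_nil t; apply: flat_le => //.
by apply: (eval_le flat_ai) => w' /tk ->; apply: flat_id.
Qed.

Lemma flat_frame_inj (v : nat -> flat) (q : bool * bool) (l u w r : term) :
  eval v (frame q l u r) = eval v (frame q l w r) ->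
  eval v (frame q l u r) <> None -> eval v u = eval v w.
Proof.
have mulIr x y z : mul y x = mul z x -> mul y x <> None -> y = z.
  by rewrite ![mul _ x]mulC; apply: mulI.
have mulN0 x y : mul x y <> None -> x <> None.
  by case: x => // + _; rewrite mulN.
case: q => [[] []] //= E E0; last exact: mulIr E E0.
  by apply: (mulI (mulIr _ _ _ E E0)); apply: mulN0 E0.
exact: mulI E E0.
Qed.

(** The identities of [ids_F] express cancellation: unless both sides are [None],
    the summands [y1 u y2] and [y1 v y2] agree, so that [u] and [v] do. *)
Lemma flat_F (p q : bool * bool) : satisfies flat (id_F p q).
Proof.
move=> v; pose fr r l u w := eval v (frame r (Var l) (Var u) (Var w)).
pose x := fr p 0 4 1; pose x' := fr p 0 5 1.
pose y := fr q 2 4 3; pose y' := fr q 2 5 3.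
have yy' : y = y' -> y <> None -> v 4 = v 5 by apply: flat_frame_inj.
rewrite -[LHS]/(x ⊕ y ⊕ y') -[RHS]/(x' ⊕ y ⊕ y') !addA.
have [E|/eqP /flat_neq->] := eqVneq (y : option T) y'; last by rewrite !flatNr.
rewrite -E flat_id; have [->|/eqP y0] := eqVneq (y : option T) None.
  by rewrite !flatNr.
suff -> : x = x' by [].
have v45 := yy' E y0.
by rewrite /x /x' /fr; case: (p) => [[] []] /=; rewrite v45.
Qed.

End Flat.

(** * The algebras A_{m,n} *)

Section Amn.
Variables m n : nat.

(** With [None] for the degrees out of range, multiplication merely adds degrees
    and group components ([Amul_elt]). *)
Definition elt (d : nat) (g : Zmod n) : Aalg m n :=
  omap (fun k => (k, g)) (insub d).

Lemma elt_none d g : ~~ (0 < d <= m) -> elt d g = None.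
Proof. by move=> dm; rewrite /elt insubN. Qed.

Lemma elt_neq_none d g : 0 < d <= m -> elt d g <> None.
Proof. by move=> dm; rewrite /elt insubT. Qed.

Lemma elt_inj d g d' g' : 0 < d <= m -> elt d g = elt d' g' -> d = d' /\ g = g'.
Proof.
move=> dm; have := elt_neq_none (g := g) dm.
rewrite /elt; case: insubP => // k _ <- _; case: insubP => // k' _ <-.
by move=> [-> ->].
Qed.

Lemma eltP (s : Aalg m n) :
  s = None \/ exists d g, 0 < d <= m /\ s = elt d g.
Proof.
case: s => [[[d dm] g]|]; [right|by left]; exists d, g; split=> //.
by rewrite /elt insubT.
Qed.

Lemma Amul_elt d g d' g' : 0 < d -> 0 < d' ->
  Amul (elt d g) (elt d' g') = elt (d + d') (g + g')%R.
Proof.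
move=> d0 d'0; rewrite {1 2}/elt; case: insubP => [k _ /= <-|].
  case: insubP => [k' _ /= <-|] //=; rewrite d'0 -ltnNge /= => d'm.
  by rewrite elt_none //; lia.
by rewrite d0 -ltnNge /= => dm; rewrite elt_none //; lia.
Qed.

Lemma AmulN (s : Acarrier m n) : Amul None s = None.
Proof. by []. Qed.

Lemma AmulC : commutative (@Amul m n).
Proof.
move=> s t; case: (eltP s) => [->|[d [g [dm ->]]]]; first by case: t => [[]|].
case: (eltP t) => [->|[d' [g' [d'm ->]]]]; first by case: (elt d g) => [[]|].
by rewrite !Amul_elt 1?addnC 1?GRing.addrC //; lia.
Qed.

Let AmulNr (s : Acarrier m n) : Amul s None = None.
Proof. by rewrite AmulC. Qed.

Lemma AmulA : associative (@Amul m n).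
Proof.
move=> s t u; case: (eltP s) => [->//|[d [g [dm ->]]]].
case: (eltP t) => [->|[d' [g' [d'm ->]]]]; first by rewrite AmulNr.
case: (eltP u) => [->|[d2 [g2 [d2m ->]]]].
  by rewrite !AmulNr.
by rewrite !Amul_elt ?addnA ?GRing.addrA //; lia.
Qed.

Lemma AmulI (s t u : Acarrier m n) :
  Amul s t = Amul s u -> Amul s t <> None -> t = u.
Proof.
case: (eltP s) => [->//|[d [g [dm ->]]]].
case: (eltP t) => [->|[d' [g' [d'm ->]]]]; first by rewrite AmulNr.
case: (eltP u) => [->|[d2 [g2 [d2m ->]]]]; first by rewrite AmulNr.
rewrite !Amul_elt; try lia; move=> E E0; have dd : 0 < d + d' <= m.
  by apply/negP=> /negP /(elt_none (g + g')%R).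
by have [/addnI -> /GRing.addrI ->] := elt_inj dd E.
Qed.

Lemma A_ai : ai_semiring (Aalg m n).
Proof. exact: flat_ai AmulA AmulC AmulN AmulI. Qed.

Lemma A_F p q : satisfies (Aalg m n) (id_F p q).
Proof. exact: (flat_F AmulC AmulN AmulI). Qed.

Lemma A_eval (v : nat -> Aalg m n) (t : term) (k : Aalg m n) :
  k <> None ->
  eval v t = k <-> (forall w, w \in words t -> wprod (wmap v w) = k).
Proof. exact: (flat_eval AmulA AmulC AmulN AmulI). Qed.

Lemma wprod_elt (X : Type) (d : X -> nat) (g : X -> Zmod n) (w : word X) :
  (forall x, 0 < d x) ->
  wprod (wmap (fun x => elt (d x) (g x)) w)
    = elt (\sum_(x <- letters w) d x) (\sum_(x <- letters w) g x)%R.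
Proof.
move=> d0; case: w => x l; rewrite /wprod /letters /=.
elim/last_ind: l => [|l y IH] /=; first by rewrite !big_seq1.
rewrite map_rcons -cats1 foldl_cat IH /= Amul_elt //.
  by rewrite -rcons_cons -cats1 !big_cat !big_seq1.
by rewrite big_cons ltn_addr.
Qed.

Definition Adeg (s : Aalg m n) : nat :=
  if s is Some (d, _) then sval d else m.+1.

Definition Agr (s : Aalg m n) : Zmod n := if s is Some (_, g) then g else 0%R.

Lemma Adeg_gt0 s : 0 < Adeg s.
Proof. by case: s => [[[k /= /andP[]]]|]. Qed.

Lemma A_eltE s : s = elt (Adeg s) (Agr s).
Proof.
case: s => [[[k km] a]|]; first by rewrite /elt insubT.
by rewrite elt_none //= ltnn.
Qed.

(** Giving [None] a degree above [m] makes the degree and the group component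
    additive without exception. *)
Lemma wprod_A (w : word (Aalg m n)) :
  wprod w = elt (\sum_(s <- letters w) Adeg s) (\sum_(s <- letters w) Agr s)%R.
Proof.
rewrite -wprod_elt; last exact: Adeg_gt0.
suff <- : w = wmap (fun s => elt (Adeg s) (Agr s)) w by [].
case: w => s l; rewrite /wmap /= -A_eltE; congr pair.
by rewrite -[LHS]map_id; apply: eq_map => t; apply: A_eltE.
Qed.

Lemma wprod_A_none (w : word (Aalg m n)) : m < size (letters w) -> wprod w = None.
Proof.
move=> mw; rewrite wprod_A; apply: elt_none; rewrite negb_and -!ltnNge orbC.
apply/orP; left; apply: leq_trans mw _.
by rewrite -sum1_size leq_sum // => s _; apply: Adeg_gt0.
Qed.

(** By [wprod_elt], the valuation mapping [x] to [elt (d x) (g x)] gives to all the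
    words in [P] one value of A_{m,n} other than [None], and to [w] another value.
    Degrees above [m] serve to give the value [None] to a letter. *)
Definition separated (X : Type) (P : word X -> Prop) (w : word X) : Prop :=
  exists (d : X -> nat) (g : X -> Zmod n) (k : nat) (h : Zmod n),
  [/\ forall x, 0 < d x,
      0 < k <= m,
      forall l, P l ->
        \sum_(x <- letters l) d x = k /\ (\sum_(x <- letters l) g x)%R = h
    & ~ (\sum_(x <- letters w) d x = k /\ (\sum_(x <- letters w) g x)%R = h)].

(** If an identity of A_{m,n} failed in [B], some word of one side would not lie
    below the value of the other side; a valuation in A_{m,n} separating it from
    the words of that side would refute the identity. *)
Lemma satisfies_of_separated (B : algebra) (v : nat -> B) (e : identity) :
  ai_semiring B -> satisfies (Aalg m n) e ->
  (forall b (w : word nat), {subset letters w <= vars (lhs e) ++ vars (rhs e)} ->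
     ~ wprod (wmap v w) ⊑ b ->
     separated (fun l => {subset letters l <= vars (lhs e) ++ vars (rhs e)} /\
                         wprod (wmap v l) ⊑ b) w) ->
  eval v (lhs e) = eval v (rhs e).
Proof.
case: e => s t /= B_ai Ast sep.
have half (s' t' : term) : (forall u : nat -> Aalg m n, eval u s' = eval u t') ->
    {subset vars s' <= vars s ++ vars t} ->
    {subset vars t' <= vars s ++ vars t} -> eval v s' ⊑ eval v t'.
  move=> st' s's t't; apply: (eval_le B_ai) => w sw; apply: contrapT => wt.
  have ws i : i \in letters w -> i \in vars s ++ vars t.
    by move=> /(letters_words sw) /s's.
  have [d [g [k [h [d0 km tkh]]]]] := sep _ _ ws wt; apply.
  pose u i := elt (d i) (g i).
  have kh0 : elt k h <> None by apply: elt_neq_none.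
  have /A_eval : eval u s' = elt k h.
    rewrite st'; apply/A_eval => // l tl; rewrite wprod_elt //.
    have lt i : i \in letters l -> i \in vars s ++ vars t.
      by move=> /(letters_words tl) /t't.
    by have [|-> ->] := tkh l; first by split=> //; apply: (le_eval B_ai).
  by move=> /(_ kh0 w sw); rewrite wprod_elt // => /esym /(elt_inj km)[-> ->].
by apply: (le_anti B_ai); apply: half => // i; rewrite mem_cat => ->; rewrite ?orbT.
Qed.

(** A grading of the elements of [B] grades the variables under every valuation,
    so that the search for it involves [b] and a word over [B] only. *)
Lemma basis_of_separated (E : seq identity) :
  model (of_seq E) (Aalg m n) ->
  (forall B : algebra, model (of_seq E) B -> ai_semiring B) ->
  (forall B : algebra, model (of_seq E) B -> forall (b : B) (w : word B),
     ~ wprod w ⊑ b -> separated (fun l => wprod l ⊑ b) w) ->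
  basis (of_seq E) (Aalg m n).
Proof.
move=> AE E_ai sep; apply: basis_completeness => // B e BE Ae v.
apply: satisfies_of_separated => //; first exact: E_ai.
move=> b w _ wb; have [d [g [k [h [d0 km lb nw]]]]] := sep B BE b _ wb.
exists (fun i => d (v i)), (fun i => g (v i)), k, h; split=> //.
  by move=> l [_ /lb]; rewrite /letters /= !big_cons !big_map.
by move: nw; rewrite /letters /= !big_cons !big_map.
Qed.

End Amn.

(** * Relations in which any path of length three has a chord *)

Section Rectangular.
Variables (T : Type) (R : T -> T -> Prop).
Hypothesis Rsym : forall x y, R x y -> R y x.
Hypothesis Rrect : forall x y z w, R x y -> R z y -> R z w -> R x w.

(** In a component, [R] joins every vertex of one side to every vertex of the
    other; the two sides coincide when the component has a loop. *)
Definition side (x y : T) : Prop := x = y \/ exists2 z, R x z & R y z.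

Lemma side_sym x y : side x y -> side y x.
Proof. by case=> [->|[z xz yz]]; [left|right; exists z]. Qed.

Lemma side_R x y z : side x y -> R x z -> R y z.
Proof. by case=> [->//|[w xw yw] xz]; apply: Rrect yw xw xz. Qed.

Lemma R_side x y z : R x y -> R y z -> side x z.
Proof. by move=> xy yz; right; exists y => //; apply: Rsym. Qed.

(** Without loops, [R] is bipartite: each component has two sides, which are
    coloured according to a chosen vertex, except that the components of [x0]
    and [y0] are coloured according to these; no edge joins [x0] to [y0], so
    that both may have the same colour. *)
Lemma colouring (x0 y0 : T) (beta : bool) :
  (forall x, ~ R x x) -> ~ R x0 y0 ->
  exists col : T -> bool,
    [/\ forall x y, R x y -> col x = ~~ col y, col x0 = beta & col y0 = beta].
Proof.
move=> loopless nR; have side_nR x y : side x y -> ~ R x y.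
  by move=> /side_R xy /xy /loopless.
pose near x := side x x0 \/ side x y0; pose far x := R x x0 \/ R x y0.
have near_far x : near x -> ~ far x.
  have nR' : ~ R y0 x0 by move/Rsym.
  move=> [] s [] /(side_R s) //; exact: loopless.
have nearR x y : R x y -> near x -> far y.
  by move=> xy [] /side_R s; [left|right]; apply/Rsym/s.
have farR x y : R x y -> far x -> near y.
  by move=> /Rsym xy []; [left|right]; apply: R_side xy _.
pose rep x := epsilon (inhabits x0) (fun z => side z x \/ R z x).
have repP x : side (rep x) x \/ R (rep x) x.
  apply: (epsilon_spec (inhabits x0) (fun z => side z x \/ R z x)).
  by exists x; left; left.
have rep_eq x y : R x y -> rep x = rep y.
  move=> xy; congr (epsilon _ _); apply/funext => z; apply/propext.
  have yx := Rsym xy; split=> -[s|zR].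
  - by right; apply: (side_R (side_sym s)).
  - by left; apply: R_side zR _.
  - by right; apply: (side_R (side_sym s)).
  - by left; apply: R_side zR _.
pose col x := if `[< near x >] then beta else
              if `[< far x >] then ~~ beta else `[< side x (rep x) >].
exists col; split=> [x y xy||]; last 2 first.
- by rewrite /col; case: asboolP => // -[]; left; left.
- by rewrite /col; case: asboolP => // -[]; right; left.
have yx := Rsym xy; rewrite /col.
case: (asboolP (near x)) => [nx|nnx].
  have fy := nearR _ _ xy nx.
  case: asboolP => [/near_far//|_]; case: asboolP => // _.
  by rewrite negbK.
case: (asboolP (far x)) => [fx|nfx].
  by case: asboolP => // -[]; apply: farR xy _.
case: (asboolP (near y)) => [/(nearR _ _ yx)//|_].
case: (asboolP (far y)) => [/(farR _ _ yx)//|_].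
rewrite -(rep_eq _ _ xy); case: (repP x) => [s|r].
  have Ry := side_R (side_sym s) xy.
  case: asboolP => [_|[]]; last exact: side_sym.
  by case: asboolP => // /side_nR[]; apply: Rsym.
case: (asboolP (side y _)) => [_|[]]; last exact: R_side yx (Rsym r).
by case: asboolP => // /side_nR[]; apply: Rsym.
Qed.

(** A component without loops admits a nonzero solution of the equations
    [g x + g y = 0]: the value [c] on one side and [- c] on the other.  If [y0] is
    not opposite to [x0], then [g y0] is 0 or [c]. *)
Lemma loopless_grading (G : zmodType) (c : G) (x0 y0 : T) :
  c != 0%R -> (c + c != 0)%R -> ~ R x0 y0 -> ~ R x0 x0 ->
  exists g : T -> G, (forall x y, R x y -> g x + g y = 0)%R /\ (g x0 + g y0 != 0)%R.
Proof.
move=> c0 cc0 nR nl; have excl x : side x x0 -> ~ R x x0.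
  by move=> /side_R s /s.
exists (fun x => if `[< side x x0 >] then c
                 else if `[< R x x0 >] then - c else 0)%R.
split=> [x y xy|].
  have yx := Rsym xy.
  case: (asboolP (side x x0)) => [sx|nsx].
    have Ry := Rsym (side_R sx xy).
    case: asboolP => [/excl//|_]; case: asboolP => // _; exact: GRing.subrr.
  case: (asboolP (R x x0)) => [Rx|nRx].
    by case: asboolP => [_|[]]; [rewrite GRing.addNr|apply: R_side yx Rx].
  case: asboolP => [/side_R/(_ yx)/Rsym//|_].
  by case: asboolP => [/(R_side xy)//|_]; rewrite GRing.addr0.
case: asboolP => [_|[]]; last by left.
case: asboolP => // _; case: asboolP => [/Rsym//|_]; first by rewrite GRing.addr0.
Qed.

(** In a component with a loop, both sides are equal and the value must be its own
    opposite. *)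
Lemma loop_grading (G : zmodType) (c : G) (x0 y0 : T) :
  c != 0%R -> (c + c = 0)%R -> ~ R x0 y0 -> R x0 x0 ->
  exists g : T -> G, (forall x y, R x y -> g x + g y = 0)%R /\ (g x0 + g y0 != 0)%R.
Proof.
move=> c0 cc0 nR l.
exists (fun x => if `[< side x x0 >] then c else 0)%R; split=> [x y xy|].
  have sideR u w : R u w -> side u x0 -> side w x0.
    by move=> uw /side_R/(_ uw) w0; apply: R_side (Rsym w0) l.
  case: asboolP => [/(sideR _ _ xy) sy|nsx]; first by case: asboolP.
  case: asboolP => [/(sideR _ _ (Rsym xy))//|_]; exact: GRing.addr0.
case: asboolP => [_|[]]; last by left.
case: asboolP => [s|_]; last by rewrite GRing.addr0.
by case: nR; apply/Rsym/(side_R (side_sym s)).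
Qed.

End Rectangular.

(** * Semirings satisfying the identities F *)

Lemma model_cat (E1 E2 : seq identity) (A : algebra) :
  model (of_seq (E1 ++ E2)) A <->
  model (of_seq E1) A /\ model (of_seq E2) A.
Proof.
rewrite /model /of_seq; split=> [mA|[m1 m2] e]; last first.
  by case/(List.in_app_or E1 E2) => [/m1|/m2].
by split=> e Ee; apply: mA; apply: (List.in_or_app E1 E2); [left|right].
Qed.

Lemma model_F (A : algebra) :
  model (of_seq ids_F) A <-> forall p q, satisfies A (id_F p q).
Proof.
split=> [mA [[] []] [[] []]|mA e]; last first.
  by rewrite /of_seq /=; do 16![case=> [<-|]; first exact: mA].
all: apply: mA; rewrite /of_seq /=; by do ![by left|right].
Qed.

Section SatisfyingF.
Variable B : algebra.
Hypotheses (B_ai : ai_semiring B) (B_F : forall p q, satisfies B (id_F p q)).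
Implicit Types (x y z u v b c : B) (p q : option B).

(** The context [None] stands for an omitted variable in the identities F. *)
Definition act p x : B := if p is Some y then y ⊗ x else x.

(** The identities F in terms of the order; left contexts are enough when the
    multiplication is commutative. *)
Lemma exchange q p u v b :
  act q u ⊑ b -> act q v ⊑ b -> act p u ⊑ b -> act p v ⊑ b.
Proof.
move=> qu qv pu; pose val := nth v [:: odflt u p; u; odflt u q; u; u].
have E : act p u ⊕ act q u ⊕ act q v = act p v ⊕ act q u ⊕ act q v.
  have := B_F (isSome p, false) (isSome q, false) val.
  by rewrite /val; case: (p) (q) => [?|] [?|].
have : act p v ⊕ act q u ⊕ act q v ⊑ b by rewrite -E; do !apply: add_le.
by case/(add_leE B_ai) => /(add_leE B_ai)[].
Qed.

(** In the context [c], all elements become equal to [c], hence interchangeable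
    below [c]. *)
Lemma absorbing_top c x : (forall y, c ⊗ y = c) -> x ⊑ c.
Proof.
move=> cM; apply: (@exchange (Some c) None c x) => /=; rewrite ?cM;
  exact: le_refl.
Qed.

(** Since [x] and [z] lie below [b] in the context [y], the edge from [z] to [t]
    yields one from [x] to [t]. *)
Lemma product_rect b x y z t :
  (forall u v, u ⊗ v = v ⊗ u) ->
  x ⊗ y ⊑ b -> z ⊗ y ⊑ b -> z ⊗ t ⊑ b -> x ⊗ t ⊑ b.
Proof.
move=> mulC; rewrite !(mulC x) !(mulC z) => xy zy zt.
exact: (@exchange (Some y) (Some t) z x b).
Qed.

End SatisfyingF.

Lemma foldl_absorbing (B : algebra) (c : B) (l : seq B) :
  (forall y, c ⊗ y = c) -> foldl (@alg_mul B) c l = c.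
Proof. by move=> cM; elim: l => //= y l; rewrite cM. Qed.

Section AddA.
Variables m n : nat.
Implicit Types s t : Aalg m n.

Lemma A_addE s t : s ⊕ t = if s == t :> Acarrier m n then s else None.
Proof. by []. Qed.

Lemma A_add_id s : s ⊕ s = s.
Proof. by rewrite A_addE eqxx. Qed.

Lemma A_add_neq s t : s <> t -> s ⊕ t = None.
Proof. by rewrite A_addE; case: eqP. Qed.

Lemma A_addN s : s ⊕ (None : Aalg m n) = None.
Proof. by rewrite A_addE; case: eqP. Qed.

Lemma A_Nadd s : (None : Aalg m n) ⊕ s = None.
Proof. by rewrite A_addE; case: eqP. Qed.

End AddA.

(** * The basis for m = 1 *)

Lemma basis1_sound n : model (of_seq basis1) (Aalg 1 n).
Proof.
apply/model_cat; split=> [|e]; first exact: A_ai.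
have N (s t : Aalg 1 n) : s ⊗ t = None by apply: (@wprod_A_none 1 n (s, [:: t])).
case=> [<-|[<-|[]]] v; cbn [lhs rhs eval]; rewrite !N //.
by rewrite A_addN.
Qed.

Theorem basis1_complete n : basis (of_seq basis1) (Aalg 1 n).
Proof.
apply: basis_of_separated => [|B /model_cat[]//|B]; first exact: basis1_sound.
move=> /model_cat[B_ai BE] b w wb.
have mulE x y z t : x ⊗ y = z ⊗ t :> B.
  exact: (model_nth (k := 0) BE isT (nth t [:: x; y; z])).
have top (x y z : B) : x ⊑ y ⊗ z := model_nth (k := 1) BE isT (nth z [:: x; y]).
have nb x y : ~ x ⊗ y ⊑ b.
  by move=> xyb; apply: wb; apply: (le_trans B_ai) xyb; apply: top.
have nl x y l : ~ wprod (x, y :: l) ⊑ b.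
  rewrite /wprod /= foldl_absorbing; first exact: nb.
  by move=> z; apply: mulE.
exists (fun x => if `[< x ⊑ b >] then 1 else 2), (fun=> 0%R), 1, 0%R; split=> //.
- by move=> x; case: ifP.
- case=> x [|y l] xb; last by case: (nl _ _ _ xb).
  rewrite !big_seq1; split=> //.
  by case: asboolP => // -[].
- move=> [+ _]; case: w wb => x [|y l] wb; rewrite /letters !big_cons.
    by rewrite big_nil; case: asboolP => // /wb.
  by do 2![case: asboolP => _]; lia.
Qed.

(** * The basis for m = 2 *)

Section Zmod.
Variable n : nat.
Hypothesis n0 : 0 < n.
Implicit Types x y z : Zmod n.

Lemma Zmod_lt x : x < n.
Proof. by apply: leq_trans (ltn_ord x) _; rewrite prednK. Qed.

Lemma Zmod_add x y : (x + y)%R = (if x + y < n then x + y else x + y - n) :> nat.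
Proof.
have [xn yn] := (Zmod_lt x, Zmod_lt y).
have -> : (x + y)%R = (x + y) %% n :> nat by case: n n0 x y xn yn.
case: ltnP => xy; first exact: modn_small.
by rewrite -{1}(subnK xy) modnDr modn_small //; lia.
Qed.

Lemma Zmod_exists k : k < n -> exists c : Zmod n, c = k :> nat.
Proof. by case: n n0 => // n' _ kn; exists (Ordinal kn). Qed.

Lemma Zmod_neq x y : (x != y) = (x != y :> nat).
Proof. by []. Qed.

Lemma Zmod_odd_double_inj x y : odd n -> (x + x = y + y)%R -> x = y.
Proof.
move=> on E; have {E} : (x + x)%R = (y + y)%R :> nat by rewrite E.
rewrite !Zmod_add => E; apply: ord_inj.
have [xn yn] := (Zmod_lt x, Zmod_lt y); move: E.
by case: (ltnP (x + x) n); case: (ltnP (y + y) n); lia.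
Qed.

Lemma Zmod_generator : 2 < n -> exists c : Zmod n, (c != 0 /\ c + c != 0)%R.
Proof.
move=> n2; have [c c1] := Zmod_exists (ltnW n2); exists c.
by rewrite !Zmod_neq Zmod_add c1 n2.
Qed.

Lemma Zmod_involution :
  1 < n -> ~~ odd n -> exists c : Zmod n, c != 0%R /\ (c + c = 0)%R.
Proof.
move=> n1 on; have [|c cn] := @Zmod_exists n./2; first lia.
exists c; split; first by rewrite Zmod_neq cn /=; lia.
apply: ord_inj; rewrite Zmod_add cn -[RHS]/0.
by case: ltnP; lia.
Qed.

End Zmod.

Lemma Z2_double (x : Zmod 2) : (x + x = 0)%R.
Proof.
apply: ord_inj; rewrite (@Zmod_add 2) // -[RHS]/0.
by have x2 := @Zmod_lt 2 isT x; case: ltnP; lia.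
Qed.

Section Basis2.
Variable n : nat.
Hypothesis n0 : 0 < n.

Lemma A2_letter (x : Aalg 2 n) :
  (exists g, x = elt 2 1 g) \/ forall y, x ⊗ y = None /\ y ⊗ x = None.
Proof.
case: (eltP x) => [->|[[|[|d]] [g [//dm ->]]]].
- by right=> y; split=> //; apply: AmulC.
- by left; exists g.
- right=> y; suff N : elt 2 d.+2 g ⊗ y = None by split=> //; rewrite -N; apply: AmulC.
  case: (eltP y) => [->|[d' [g' [d'm ->]]]]; first exact: AmulC.
  by rewrite [LHS]Amul_elt ?elt_none //; lia.
Qed.

Lemma basis2_sound : model (of_seq (basis2 n)) (Aalg 2 n).
Proof.
have N3 (x y z : Aalg 2 n) : x ⊗ y ⊗ z = None.
  by apply: (@wprod_A_none 2 n (x, [:: y; z])).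
have sq (x y : Aalg 2 n) : x = y -> (x ⊕ y) ⊗ (x ⊕ y) = x ⊗ x ⊕ y ⊗ y.
  by move=> ->; rewrite !A_add_id.
apply/model_cat; split.
  apply/model_cat; split; first exact: A_ai.
  apply/model_cat; split; first by apply/model_F; apply: A_F.
  by move=> e [<-|[<-|[]]] v; cbn [lhs rhs eval]; rewrite ?N3 //; apply: AmulC.
have [n1|n1] := eqVneq n 1.
  move=> e [<-|[]] v; cbn [lhs rhs eval].
  case: (A2_letter (v 0)) => [[g ->]|x0]; last by rewrite !(x0 _).1 A_Nadd.
  case: (A2_letter (v 1)) => [[h ->]|y0]; last by rewrite (y0 _).1 (y0 _).2 A_addN.
  suff -> : g = h by rewrite A_add_id.
  apply: ord_inj; have := (Zmod_lt n0 g, Zmod_lt n0 h).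
  by case; rewrite {2 4}n1; lia.
have [n2|n2] := eqVneq n 2.
  move=> e [<-|[]] v; cbn [lhs rhs eval].
  case: (A2_letter (v 0)) => [[g ->]|x0]; last by rewrite !(x0 _).1 !A_Nadd.
  case: (A2_letter (v 1)) => [[h ->]|y0]; last by rewrite !(y0 _).1 !A_addN.
  case: (A2_letter (v 2)) => [[h' ->]|z0]; last first.
    by rewrite (z0 _).2 A_addN A_Nadd.
  have mulE k k' : elt 2 1 k ⊗ elt 2 1 k' = elt 2 2 (k + k')%R by apply: Amul_elt.
  rewrite !mulE; move: g h h'; rewrite n2 => g h h'; rewrite !Z2_double.
  have [->|/eqP E] := eqVneq (elt 2 2 (h + h')%R) (elt 2 2 (0%R : Zmod 2)).
    by rewrite !A_add_id.
  by rewrite (@A_add_neq _ _ (elt 2 2 0%R)) ?A_Nadd // => /esym.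
case: ifP => [on|_] e [] // <- v; cbn [lhs rhs eval].
have [/sq//|/eqP xy] := eqVneq (v 0 : Acarrier 2 n) (v 1).
rewrite (A_add_neq xy) [LHS]/=; apply/esym.
case: (A2_letter (v 0)) => [[g x]|x0]; last by rewrite !(x0 _).1 !A_Nadd.
case: (A2_letter (v 1)) => [[h y]|y0]; last by rewrite !(y0 _).1 !A_addN.
apply: A_add_neq; rewrite x y => E; apply: xy; rewrite x y.
move: E; rewrite -[_ ⊗ _]/(Amul _ _) -[RHS]/(Amul _ _) !Amul_elt //.
by move=> /elt_inj[//|_ /(Zmod_odd_double_inj n0 on) ->].
Qed.

Section Complete.
Variable B : algebra.
Hypothesis BE : model (of_seq (basis2 n)) B.

Let B_ids : [/\ ai_semiring B, forall p q, satisfies B (id_F p q),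
  (forall x y : B, x ⊗ y = y ⊗ x) &
  (forall x y z x' y' z' : B, x ⊗ y ⊗ z = x' ⊗ y' ⊗ z')].
Proof.
have /model_cat[] := BE.
move=> /model_cat[B_ai /model_cat[/model_F B_F BE']] _.
split=> // [x y|x y z x' y' z'].
  exact: (model_nth (k := 0) BE' isT (nth y [:: x])).
exact: (model_nth (k := 1) BE' isT (nth z' [:: x; y; z; x'; y'])).
Qed.

Let B_ai : ai_semiring B. Proof. by case: B_ids. Qed.
Let B_F : forall p q, satisfies B (id_F p q). Proof. by case: B_ids. Qed.
Let mulC (x y : B) : x ⊗ y = y ⊗ x. Proof. by case: B_ids. Qed.
Let mul3 (x y z x' y' z' : B) : x ⊗ y ⊗ z = x' ⊗ y' ⊗ z'.
Proof. by case: B_ids. Qed.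

Variables (b : B) (w : word B).
Hypothesis wb : ~ wprod w ⊑ b.

Let R (x y : B) : Prop := x ⊗ y ⊑ b.

Let Rsym x y : R x y -> R y x.
Proof. by rewrite /R mulC. Qed.

Let Rrect x y z t : R x y -> R z y -> R z t -> R x t.
Proof. exact: product_rect. Qed.

Let mul3b x y z : ~ x ⊗ y ⊗ z ⊑ b.
Proof.
move=> cb; apply: wb; apply: (le_trans B_ai) cb.
by apply: (absorbing_top B_ai B_F) => t; apply: mul3.
Qed.

Let long x y z l : ~ wprod (x, [:: y, z & l]) ⊑ b.
Proof. by rewrite /wprod /= foldl_absorbing => [/mul3b//|t]; apply: mul3. Qed.

Let letter_factor x y : x ⊑ b -> ~ R x y.
Proof.
move=> xb xy; apply: (@mul3b y x y).
rewrite (ai_mulA B_ai).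
by apply: (@exchange _ B_ai B_F None (Some y) x (x ⊗ y) b) => //; apply: Rsym.
Qed.

(** The additional identity of [basis2 n] makes up for the solutions missing in
    Z_n.  For n >= 3, a component without loops can be graded on its own by an
    element [c] with [c + c != 0], and one with loops by an involution.  If n is
    odd there is no involution, and the identity joins all loops.  For n = 2
    only involutions exist: either there is a loop, which the identity then spreads
    to all components, or the graph is bipartite and a colouring gives a solution
    for the nonzero [h].  For n = 1 the identity joins all letters. *)
Let grading x0 y0 :
  ~ R x0 y0 -> (exists z, R x0 z) -> (exists z, R y0 z) ->
  exists (g : B -> Zmod n) (h : Zmod n),
    (forall x y, R x y -> g x + g y = h)%R /\ (g x0 + g y0 != h)%R.
Proof.
move=> nR [x1 x01] [y1 y01]; have /model_cat[_ BE'] := BE.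
have [n1|n1] := eqVneq n 1.
  move: BE'; rewrite n1 => BE'.
  have xyE (x y : B) : x ⊗ y = x ⊗ x ⊕ y ⊗ y.
    exact: (model_nth (k := 0) BE' isT (nth y [:: x])).
  case: nR; rewrite /R xyE; apply: (add_le B_ai).
    by move: x01; rewrite /R xyE => /(add_leE B_ai)[].
  by move: y01; rewrite /R xyE => /(add_leE B_ai)[].
have n_gt1 : 1 < n by lia.
have [n2|n2] := eqVneq n 2.
  have [] := @Zmod_involution n n0 n_gt1; first by rewrite n2.
  move=> c [c0 cc].
  have [[z l]|nl] := pselect (exists z, R z z).
    have [|g [gR g0]] := loop_grading Rsym Rrect c0 cc nR _; last by exists g, 0%R.
    move: BE'; rewrite n2 => BE'.
    have E : z ⊗ z ⊕ x0 ⊗ x1 = z ⊗ z ⊕ x0 ⊗ x1 ⊕ x0 ⊗ x0.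
      exact: (model_nth (k := 0) BE' isT (nth x1 [:: z; x0])).
    have : z ⊗ z ⊕ x0 ⊗ x1 ⊑ b by apply: (add_le B_ai).
    by rewrite E => /(add_leE B_ai)[].
  have [|col [colR colx coly]] := colouring Rsym Rrect true _ nR.
    by move=> z l; apply: nl; exists z.
  exists (fun x => if col x then c else 0%R), c; split=> [x y /colR ->|].
    by case: (col y) => /=; rewrite ?GRing.add0r ?GRing.addr0.
  by rewrite colx coly cc eq_sym.
have n_gt2 : 2 < n by lia.
have [lx|lx] := pselect (R x0 x0); last first.
  have [c [c0 cc]] := Zmod_generator n0 n_gt2.
  by have [g [gR g0]] := loopless_grading Rsym Rrect c0 cc nR lx; exists g, 0%R.
have [ly|ly] := pselect (R y0 y0); last first.
  have [c [c0 cc]] := Zmod_generator n0 n_gt2.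
  have [|g [gR g0]] := loopless_grading Rsym Rrect c0 cc _ ly (y0 := x0).
    by move/Rsym.
  by exists g, 0%R; split=> //; rewrite GRing.addrC.
have [on|on] := boolP (odd n).
  case: nR; move: BE'; rewrite (negbTE n1) (negbTE n2) on => BE'.
  have E : (x0 ⊕ y0) ⊗ (x0 ⊕ y0) = x0 ⊗ x0 ⊕ y0 ⊗ y0.
    exact: (model_nth (k := 0) BE' isT (nth y0 [:: x0])).
  have : (x0 ⊕ y0) ⊗ (x0 ⊕ y0) ⊑ b by rewrite E; apply: (add_le B_ai).
  by apply: (le_trans B_ai); apply: (le_mul B_ai); [apply: le_addl|apply: le_addr].
have [c [c0 cc]] := Zmod_involution n0 n_gt1 on.
by have [g [gR g0]] := loop_grading Rsym Rrect c0 cc nR lx; exists g, 0%R.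
Qed.

(** All words below [b] get degree two: the letters below [b] have degree two, the
    factors of products below [b] have degree one.  The group component matters
    only if [w] is a product of two such factors. *)
Lemma basis2_separated : separated 2 n (fun l => wprod l ⊑ b) w.
Proof.
pose D x := exists y, R x y.
pose d x := if `[< x ⊑ b >] then 2 else if `[< D x >] then 1 else 3.
have d0 x : 0 < d x by rewrite /d; case: ifP => // _; case: ifP.
have dD x y : R x y -> d x = 1.
  move=> xy; rewrite /d; case: asboolP => [/letter_factor/(_ xy)//|_].
  by case: asboolP => // -[]; exists y.
have [g [h [gR gw]]] : exists (g : B -> Zmod n) (h : Zmod n),
    (forall x y, R x y -> g x + g y = h)%R /\
    (forall x y, w = (x, [:: y]) -> D x -> D y -> g x + g y != h)%R.
  have [[x [y [wE Dx Dy]]]|nw] :=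
      pselect (exists x y, [/\ w = (x, [:: y]), D x & D y]).
    have nR : ~ R x y by move: wb; rewrite wE.
    have [g [h [gR g0]]] := grading nR Dx Dy; exists g, h; split=> // x' y'.
    by rewrite wE => -[<- <-].
  exists (fun=> 0%R), 0%R; split=> [*|x y wE Dx Dy]; first exact: GRing.addr0.
  by case: nw; exists x, y.
exists d, (fun x => if `[< x ⊑ b >] then h else g x), 2, h; split=> //.
  move=> [x [|y [|z l]]] xb; last by case: (long xb).
    rewrite /letters !big_seq1 /d.
    by case: asboolP => // -[].
  rewrite /letters /= !big_cons !big_nil addn0 GRing.addr0.
  rewrite (dD _ _ xb) (dD _ _ (Rsym xb)) -(gR _ _ xb); split=> //.
  case: asboolP => [/letter_factor/(_ xb)//|_].
  by case: asboolP => [/letter_factor/(_ (Rsym xb))//|_].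
case: w wb gw => x [|y [|z l]] nxb gw'; rewrite /letters.
- by rewrite big_seq1 /d => -[]; case: asboolP => [/nxb//|_]; case: ifP.
- rewrite /= !big_cons !big_nil addn0 GRing.addr0 => -[dxy].
  have dx : d x = 1 by have := d0 x; have := d0 y; lia.
  have dy : d y = 1 by lia.
  move: dx dy; rewrite /d; case: asboolP => // _; case: asboolP => // Dx _.
  by case: asboolP => // _; case: asboolP => // Dy _; apply/eqP/gw'.
- rewrite /= !big_cons => -[+ _]; move: (d0 x) (d0 y) (d0 z).
  by move: (bigop _ _ _) => s; lia.
Qed.

End Complete.

Theorem basis2_complete : basis (of_seq (basis2 n)) (Aalg 2 n).
Proof.
apply: basis_of_separated => [|B|B BE b w]; first exact: basis2_sound.
  by move=> /model_cat[/model_cat[]].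
exact: basis2_separated.
Qed.

End Basis2.

(** * The basis for m = 3 and n = 1 *)

(** In A_{3,1} an element is determined by its degree, where [None] has degree
    four; [deg31] turns a check of an identity into arithmetic. *)
Definition deg31 (d : nat) : Aalg 3 1 := elt 3 d 0%R.

Lemma deg31P (x : Aalg 3 1) : exists2 i, i < 4 & x = deg31 i.+1.
Proof.
case: (eltP x) => [->|[d [g [/andP[d0 d3] ->]]]].
  by exists 3; rewrite // /deg31 elt_none.
exists d.-1; first lia.
rewrite /deg31 prednK //; congr elt; exact: ord1.
Qed.

Lemma deg31_mul d d' : deg31 d.+1 ⊗ deg31 d'.+1 = deg31 (d.+1 + d'.+1).
Proof. by rewrite [LHS]Amul_elt // GRing.addr0. Qed.

Lemma deg31_min d : deg31 d = deg31 (minn d 4).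
Proof.
have [d4|d4] := boolP (d <= 4); first by rewrite (minn_idPl d4).
by rewrite (_ : minn d 4 = 4) /deg31 ?elt_none //; lia.
Qed.

Lemma deg31_add d d' :
  deg31 d.+1 ⊕ deg31 d'.+1 = deg31 (if d.+1 == d'.+1 then d.+1 else 4).
Proof.
case: eqVneq => [<-|/eqP dd]; first exact: A_add_id.
have N4 : deg31 4 = None by apply: elt_none.
have [d3|d3] := boolP (d.+1 <= 3); last first.
  by rewrite (deg31_min d.+1) (_ : minn _ _ = 4) ?N4 ?A_Nadd //; lia.
by rewrite N4; apply: A_add_neq => /elt_inj[].
Qed.

Lemma basis3_sound : model (of_seq basis3) (Aalg 3 1).
Proof.
apply/model_cat; split; first exact: A_ai.
apply/model_cat; split; first by apply/model_F; apply: A_F.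
have N4 (x y z t : Aalg 3 1) : x ⊗ y ⊗ z ⊗ t = None.
  by apply: (@wprod_A_none 3 1 (x, [:: y; z; t])).
move=> e [<-|[<-|[<-|[<-|[<-|[<-|[<-|[]]]]]]]] v; cbn [lhs rhs eval].
- exact: AmulC.
- by rewrite !N4.
all: move: (v 0) (v 1) (v 2) => x y z.
all: case: (deg31P x) => [[|[|[|[|//]]]] _ ->].
all: case: (deg31P y) => [[|[|[|[|//]]]] _ ->].
all: case: (deg31P z) => [[|[|[|[|//]]]] _ ?]; subst z.
all: rewrite !(deg31_mul, deg31_add) /=.
all: by rewrite deg31_min [RHS]deg31_min.
Qed.

Section Basis3.
Variable B : algebra.
Hypothesis BE : model (of_seq basis3) B.

Let B_ids : [/\ ai_semiring B, forall p q, satisfies B (id_F p q),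
  (forall x y : B, x ⊗ y = y ⊗ x) &
  (forall x y z t x' y' z' t' : B, x ⊗ y ⊗ z ⊗ t = x' ⊗ y' ⊗ z' ⊗ t')].
Proof.
have /model_cat[B_ai /model_cat[/model_F B_F BE']] := BE.
split=> // [x y|x y z t x' y' z' t'].
  exact: (model_nth (k := 0) BE' isT (nth y [:: x])).
exact: (model_nth (k := 1) BE' isT (nth t' [:: x; y; z; t; x'; y'; z'])).
Qed.

Let B_ai : ai_semiring B. Proof. by case: B_ids. Qed.
Let B_F : forall p q, satisfies B (id_F p q). Proof. by case: B_ids. Qed.
Let mulC (x y : B) : x ⊗ y = y ⊗ x. Proof. by case: B_ids. Qed.
Let mul4 (x y z t x' y' z' t' : B) : x ⊗ y ⊗ z ⊗ t = x' ⊗ y' ⊗ z' ⊗ t'.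
Proof. by case: B_ids. Qed.
Let mulA (x y z : B) : x ⊗ y ⊗ z = x ⊗ (y ⊗ z) := ai_mulA B_ai x y z.
Let mulCA (x y z : B) : x ⊗ (y ⊗ z) = y ⊗ (x ⊗ z).
Proof. by rewrite -!mulA (mulC x y). Qed.
Let exchangeB := @exchange _ B_ai B_F.

Variables (b : B) (w : word B).
Hypothesis wb : ~ wprod w ⊑ b.

Let mul4b x y z t : ~ x ⊗ y ⊗ z ⊗ t ⊑ b.
Proof.
move=> cb; apply: wb; apply: (le_trans B_ai) cb.
by apply: (absorbing_top B_ai B_F) => s; rewrite mulA; apply: mul4.
Qed.

Let long x y z t l : ~ wprod (x, [:: y, z, t & l]) ⊑ b.
Proof.
rewrite /wprod /= foldl_absorbing; first exact: mul4b.
by move=> s; rewrite mulA; apply: mul4.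
Qed.

Let R (x y : B) : Prop := x ⊗ y ⊑ b.

Let Rsym x y : R x y -> R y x.
Proof. by rewrite /R mulC. Qed.

Let Rrect x y z t : R x y -> R z y -> R z t -> R x t.
Proof. exact: product_rect. Qed.

Let letter_factor x y : x ⊑ b -> ~ R x y.
Proof.
move=> xb xy; have swap p : act p x ⊑ b -> act p (x ⊗ y) ⊑ b.
  by apply: (@exchangeB None p x (x ⊗ y) b).
have := swap (Some y) (Rsym xy); rewrite /act -mulA (mulC y x) => xyy.
have := swap (Some (y ⊗ y)); rewrite /act mulC -mulA => /(_ xyy).
by rewrite -mulA; apply: mul4b.
Qed.

(** Cubes below [b]; by the last identity of the basis, these letters are the
    ones that occur in products of three letters below [b]. *)
Let Q x : Prop := x ⊗ x ⊗ x ⊑ b.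

Let BE' : model (of_seq (drop 22 basis3)) B.
Proof. by have /model_cat[_ /model_cat[_]] := BE. Qed.

Let cubes_le x y : Q x -> Q y -> x ⊗ (x ⊗ y) ⊑ b.
Proof.
move=> Qx Qy.
have E : (x ⊕ y) ⊗ (x ⊕ y) ⊗ (x ⊕ y) = x ⊗ x ⊗ x ⊕ y ⊗ y ⊗ y.
  exact: (model_nth (k := 3) BE' isT (nth y [:: x])).
have : (x ⊕ y) ⊗ (x ⊕ y) ⊗ (x ⊕ y) ⊑ b by rewrite E; apply: (add_le B_ai).
apply: (le_trans B_ai); rewrite -mulA.
do !apply: (le_mul B_ai); by [apply: le_addl|apply: le_addr].
Qed.

Let squares_le x y : R x x -> R y y -> R x y.
Proof.
move=> Rx Ry.
have E : (x ⊕ y) ⊗ (x ⊕ y) = x ⊗ x ⊕ y ⊗ y.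
  exact: (model_nth (k := 2) BE' isT (nth y [:: x])).
have : (x ⊕ y) ⊗ (x ⊕ y) ⊑ b by rewrite E; apply: (add_le B_ai).
by apply: (le_trans B_ai); apply: (le_mul B_ai); [apply: le_addl|apply: le_addr].
Qed.

Let square_edge x y z : R x x -> R y z -> R y y.
Proof.
move=> xx yz.
have E : x ⊗ x ⊕ y ⊗ z = x ⊗ x ⊕ y ⊗ z ⊕ y ⊗ y.
  exact: (model_nth (k := 4) BE' isT (nth z [:: x; y])).
have : x ⊗ x ⊕ y ⊗ z ⊑ b by apply: (add_le B_ai).
by rewrite E => /(add_leE B_ai)[].
Qed.

Let square_cube x y : R x x -> ~ Q y.
Proof.
move=> xx yyy; apply: (@mul4b x x x x).
have <- : x ⊗ x ⊕ y ⊗ y ⊗ y = x ⊗ x ⊗ x ⊗ x.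
  exact: (model_nth (k := 5) BE' isT (nth y [:: x])).
exact: (add_le B_ai).
Qed.

Let product_cube x y z : x ⊗ (y ⊗ z) ⊑ b -> Q x.
Proof.
rewrite -mulA.
have -> : x ⊗ y ⊗ z = x ⊗ y ⊗ z ⊕ x ⊗ x ⊗ x.
  exact: (model_nth (k := 6) BE' isT (nth z [:: x; y])).
by case/(add_leE B_ai).
Qed.

Let product_cubes x y z : x ⊗ y ⊗ z ⊑ b -> [/\ Q x, Q y & Q z].
Proof.
rewrite mulA => xyz; split; first exact: product_cube xyz.
  by move: xyz; rewrite mulCA; apply: product_cube.
by move: xyz; rewrite (mulC y) mulCA; apply: product_cube.
Qed.

Let Q_exchange x y z : Q x -> Q y -> R x z -> R y z.
Proof.
move=> Qx Qy xz; apply: Rsym.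
apply: (@exchangeB (Some (x ⊗ x)) (Some z) x y b) => //=.
- by rewrite mulA; apply: cubes_le.
- exact: Rsym.
Qed.

Let Q_product x y z : Q x -> Q y -> Q z -> x ⊗ y ⊗ z ⊑ b.
Proof.
by move=> Qx Qy Qz; rewrite mulC; apply: Q_exchange Qx Qz (cubes_le Qx Qy).
Qed.

(** The letters that some letter of [Q] completes to a product below [b]: they
    have degree two when the letters of [Q] have degree one. *)
Let D2 y : Prop := exists2 z, Q z & R z y.

Let Q_D2_edge x y : Q x -> D2 y -> R x y.
Proof. by move=> Qx [z Qz zy]; apply: Q_exchange zy. Qed.

Let D2_edge x y : R x y -> D2 y -> Q x.
Proof.
move=> xy [z Qz zy]; suff : z ⊗ z ⊗ x ⊑ b by case/product_cubes.
apply: (@exchangeB (Some y) (Some (z ⊗ z)) z x b) => //; exact: Rsym.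
Qed.

Let Q_D2 x : Q x -> ~ D2 x.
Proof. by move=> Qx /(Q_D2_edge Qx) xx; apply: square_cube xx Qx. Qed.

Let cube_square_free y : Q y -> forall x, ~ R x x.
Proof. by move=> Qy x xx; apply: square_cube xx Qy. Qed.

Let Q_letter x : Q x -> ~ x ⊑ b.
Proof. by rewrite /Q mulA => xxx xb; apply: letter_factor xb xxx. Qed.

Let D x : Prop := exists y, R x y.

(** The letters outside [Q] and [D2] that occur in products below [b] are free to
    have degree one or two, as long as their partners have the other one. *)
Let degree3 (col : B -> bool) (x : B) : nat :=
  if `[< x ⊑ b >] then 3 else if `[< Q x >] then 1 else if `[< D2 x >] then 2
  else if `[< D x >] then (if col x then 1 else 2) else 4.

Variant degree3_spec (col : B -> bool) (x : B) : nat -> Prop :=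
| Degree3Letter of x ⊑ b : degree3_spec col x 3
| Degree3Q of Q x : degree3_spec col x 1
| Degree3D2 of D2 x : degree3_spec col x 2
| Degree3Free of D x & ~ Q x & ~ D2 x :
    degree3_spec col x (if col x then 1 else 2)
| Degree3Other of ~ D x : degree3_spec col x 4.

Let degree3P col x : degree3_spec col x (degree3 col x).
Proof.
rewrite /degree3; case: asboolP => [xb|_]; first by constructor 1.
case: asboolP => [Qx|nQ]; first by constructor 2.
case: asboolP => [Dx|nD2]; first by constructor 3.
by case: asboolP => Dx; [constructor 4|constructor 5].
Qed.

Let degree3_gt0 col x : 0 < degree3 col x.
Proof. by case: degree3P => // *; case: ifP. Qed.

Let degree3_separated (col : B -> bool) :
  (forall x y, R x y -> col x = ~~ col y) ->
  \sum_(x <- letters w) degree3 col x <> 3 ->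
  separated 3 1 (fun l => wprod l ⊑ b) w.
Proof.
move=> colR w3; exists (degree3 col), (fun=> 0%R), 3, 0%R.
split=> //; last by case.
move=> l lb; split; last by rewrite big1.
case: l lb => x [|y [|z [|t l]]] lb; rewrite /letters /= !big_cons ?big_nil ?addn0.
- by rewrite /degree3; case: asboolP.
- have yx := Rsym lb; have Dx : D x by exists y.
  have Dy : D y by exists x.
  have nLx : ~ x ⊑ b by move/letter_factor/(_ lb).
  have nLy : ~ y ⊑ b by move/letter_factor/(_ yx).
  have D2y : Q x -> D2 y by exists x.
  have D2x : Q y -> D2 x by exists y.
  have Qx := D2_edge lb; have Qy := D2_edge yx.
  have nQ2x := @Q_D2 x; have nQ2y := @Q_D2 y.
  case: (degree3P col x) => [?|?|?|? ? ?|?];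
  case: (degree3P col y) => [?|?|?|? ? ?|?] //; try (exfalso; tauto).
  by rewrite (colR _ _ lb); case: (col y).
- have [Qx Qy Qz] := product_cubes lb.
  have Q1 s : Q s -> degree3 col s = 1.
    move=> Qs; rewrite /degree3; case: asboolP => [/(Q_letter Qs)//|_].
    by case: asboolP.
  by rewrite !Q1.
- by case: (long lb).
Qed.

Let degree3_near (col : B -> bool) x : ~ x ⊑ b -> col x -> degree3 col x != 3.
Proof. by move=> xb cx; case: degree3P => // *; rewrite cx. Qed.

Let degree2 (x : B) : nat :=
  if `[< x ⊑ b >] then 2 else if `[< D x >] then 1 else 3.

Let degree2_gt0 x : 0 < degree2 x.
Proof. by rewrite /degree2; case: ifP => // _; case: ifP. Qed.

Let degree2_D x : degree2 x = 1 -> D x.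
Proof. by rewrite /degree2; case: asboolP => // _; case: asboolP. Qed.

Let degree2_separated :
  (forall x, ~ Q x) -> \sum_(x <- letters w) degree2 x <> 2 ->
  separated 3 1 (fun l => wprod l ⊑ b) w.
Proof.
move=> nQ w2; exists degree2, (fun=> 0%R), 2, 0%R.
split=> //; last by case.
move=> l lb; split; last by rewrite big1.
case: l lb => x [|y [|z [|t l]]] lb; rewrite /letters /= !big_cons ?big_nil ?addn0.
- by rewrite /degree2; case: asboolP.
- have D1 s s' : R s s' -> degree2 s = 1.
    move=> ss; rewrite /degree2; case: asboolP => [/letter_factor/(_ ss)//|_].
    by case: asboolP => // -[]; exists s'.
  by rewrite (D1 _ _ lb) (D1 _ _ (Rsym lb)).
- by have [/nQ] := product_cubes lb.
- by case: (long lb).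
Qed.

(** The total degree of the words below [b] is three if some cube lies below [b],
    and two if some square does; these are exclusive.  If neither a cube nor a
    square lies below [b], both degrees are possible: degree two separates the
    words of length at least three, degree three the shorter ones.  With degree
    three, the colouring is chosen so that two factors of [w] do not have the
    degrees one and two, or so that a factor outside [Q] has degree two. *)
Lemma basis3_separated : separated 3 1 (fun l => wprod l ⊑ b) w.
Proof.
have [[q Qq]|nQ] := pselect (exists x, Q x); last first.
  have {}nQ x : ~ Q x by move=> Qx; apply: nQ; exists x.
  have nD2 x : ~ D2 x by case=> z /nQ.
  have [[q qq]|nR] := pselect (exists x, R x x).
    apply: degree2_separated => //.
    case: w wb => x [|y l] nb; rewrite /letters /= !big_cons ?big_nil ?addn0.
      rewrite /degree2; case: asboolP => // _; by case: ifP.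
    case: l nb => [|z l] nb; rewrite ?big_cons ?big_nil ?addn0.
      move: (degree2_gt0 x) (degree2_gt0 y) => dx dy dxy; case: nb.
      have [x' xx'] : D x by apply: degree2_D; lia.
      have [y' yy'] : D y by apply: degree2_D; lia.
      by apply: squares_le; [apply: square_edge qq xx'|apply: square_edge qq yy'].
    move: (degree2_gt0 x) (degree2_gt0 y) (degree2_gt0 z).
    by move: (bigop _ _ _) => s; lia.
  have {}nR x : ~ R x x by move=> xx; apply: nR; exists x.
  case: (w) wb (@degree2_separated nQ) (@degree3_separated)
    => x [|y [|z l]] nb sep2 sep3.
  - have [col [colR cx _]] := colouring Rsym Rrect true nR (nR x).
    apply: (sep3 col) => //; rewrite /letters big_seq1; exact/eqP/degree3_near.
  - have [col [colR cx cy]] := colouring Rsym Rrect true nR nb.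
    apply: (sep3 col) => //; rewrite /letters /= !big_cons big_nil addn0.
    case: (degree3P col x) => [_|/nQ//|/nD2//|_ _ _|_];
    case: (degree3P col y) => [_|/nQ//|/nD2//|_ _ _|_]; by rewrite ?cx ?cy.
  - apply: sep2; rewrite /letters /= !big_cons.
    move: (degree2_gt0 x) (degree2_gt0 y) (degree2_gt0 z).
    by move: (bigop _ _ _) => s; lia.
have nR := cube_square_free Qq.
case: (w) wb (@degree3_separated) => x [|y [|z [|t l]]] nb sep3.
- have [col [colR cx _]] := colouring Rsym Rrect true nR (nR x).
  apply: (sep3 col) => //; rewrite /letters big_seq1; exact/eqP/degree3_near.
- (* A free letter gets degree two next to a letter of [D2], and degree one
     otherwise; in neither case is the sum three. *)
  have [col [colR cx cy]] :=
    colouring Rsym Rrect (~~ `[< D2 x \/ D2 y >]) nR nb.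
  apply: (sep3 col) => //; rewrite /letters /= !big_cons big_nil addn0.
  have nQ2x := @Q_D2 x; have nQ2y := @Q_D2 y.
  have nxy : Q x -> ~ D2 y by move=> Qx /(Q_D2_edge Qx).
  have nyx : Q y -> ~ D2 x by move=> Qy /(Q_D2_edge Qy) /Rsym.
  move: cx cy; case: (asboolP (D2 x \/ D2 y)) => /= D2xy cx cy;
  case: (degree3P col x) => [?|?|?|? ? ?|?]; case: (degree3P col y) => [?|?|?|? ? ?|?];
  by rewrite ?cx ?cy //; exfalso; tauto.
- have [Qx|nQx] := pselect (Q x); last first.
    have [col [colR cx _]] := colouring Rsym Rrect false nR (nR x).
    apply: (sep3 col) => //; rewrite /letters /= !big_cons big_nil addn0.
    have : 1 < degree3 col x by case: degree3P => // *; rewrite cx.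
    by move: (degree3_gt0 col y) (degree3_gt0 col z); lia.
  have [Qy|nQy] := pselect (Q y); last first.
    have [col [colR cx _]] := colouring Rsym Rrect false nR (nR y).
    apply: (sep3 col) => //; rewrite /letters /= !big_cons big_nil addn0.
    have : 1 < degree3 col y by case: degree3P => // *; rewrite cx.
    by move: (degree3_gt0 col x) (degree3_gt0 col z); lia.
  have [Qz|nQz] := pselect (Q z); last first.
    have [col [colR cx _]] := colouring Rsym Rrect false nR (nR z).
    apply: (sep3 col) => //; rewrite /letters /= !big_cons big_nil addn0.
    have : 1 < degree3 col z by case: degree3P => // *; rewrite cx.
    by move: (degree3_gt0 col x) (degree3_gt0 col y); lia.
  by case: nb; apply: Q_product.
- have [col [colR _ _]] := colouring Rsym Rrect true nR (nR x).
  apply: (sep3 col) => //; rewrite /letters /= !big_cons.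
  move: (degree3_gt0 col x) (degree3_gt0 col y) (degree3_gt0 col z) (degree3_gt0 col t).
  by move: (bigop _ _ _) => s; lia.
Qed.

End Basis3.

Theorem basis3_complete : basis (of_seq basis3) (Aalg 3 1).
Proof.
apply: basis_of_separated => [|B|B BE b w]; first exact: basis3_sound.
  by move=> /model_cat[].
exact: basis3_separated.
Qed.

(** * A Moebius ladder with one triple removed *)

Section Ladder.
Variable N : nat.

(** The points are the rails 0, ..., 2N-1 and the rungs 2N, ..., 3N-1.  The rail
    [x], the rail [x + 1] and the rung [2N + (x mod N)] form a line; read modulo
    2N, the same rule would give one more triple, formed by 2N-1, 0 and 3N-1. *)
Definition line (x y z : nat) : bool :=
  [&& y == x.+1, y < N.*2 &
      (x < N) && (z == N.*2 + x) || (N <= x) && (z == N + x)].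

Definition triple (x y z : nat) : bool :=
  [|| line x y z, line y x z, line x z y, line z x y, line y z x | line z y x].

Lemma triple_swap x y z : triple x y z = triple y x z.
Proof. by rewrite /triple; do 6!case: (line _ _ _). Qed.

Lemma triple_rot x y z : triple x y z = triple y z x.
Proof. by rewrite /triple; do 6!case: (line _ _ _). Qed.

Lemma lineP x y z :
  reflect (exists k, [/\ x = k \/ x = k + N, y = x.+1, y < N.*2, k < N & z = N.*2 + k])
          (line x y z).
Proof.
rewrite /line; apply: (iffP and3P) => [[/eqP -> xN /orP[/andP[xN' /eqP ->]|]]|].
- by exists x; split=> //; left.
- move=> /andP[Nx /eqP ->]; exists (x - N); split; lia.
- move=> [k [[->|->] -> kN kN' ->]]; split=> //; lia.
Qed.

Lemma triple_fun x y z z' : triple x y z -> triple x y z' -> z = z'.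
Proof.
have tripleP a b c : triple a b c ->
    [\/ line a b c \/ line b a c, line a c b \/ line c a b
      | line b c a \/ line c b a].
  by case/or4P=> [l|l|l|/or3P[l|l|l]];
    by [constructor 1; tauto|constructor 2; tauto|constructor 3; tauto].
move=> /tripleP[][] /lineP[k [k1 k2 k3 k4 k5]].
all: by move=> /tripleP[][] /lineP[l [l1 l2 l3 l4 l5]]; lia.
Qed.

(** The lines through the rung [2N + j] are exempted: the ladder is cut there.
    Without a cut, all labellings would also give the missing triple the sum one,
    by [ladder_equation]. *)
Definition good (j : nat) (e : nat -> bool) : Prop :=
  forall x y z, line x y z -> z <> N.*2 + j -> e x + e y + e z = 1.

Lemma good_triple j e x y z :
  good j e -> x <> N.*2 + j -> y <> N.*2 + j -> z <> N.*2 + j ->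
  triple x y z -> e x + e y + e z = 1.
Proof.
move=> ge xj yj zj /or4P[/ge|/ge|/ge|/or3P[/ge|/ge|/ge]];
  by [move/(_ zj); lia|move/(_ yj); lia|move/(_ xj); lia].
Qed.

Definition label (rail rung : nat -> bool) (x : nat) : bool :=
  if x < N.*2 then rail x else rung (x - N.*2).

Lemma label_rail rail rung x : x < N.*2 -> label rail rung x = rail x.
Proof. by rewrite /label => ->. Qed.

Lemma label_rung rail rung k : label rail rung (N.*2 + k) = rung k.
Proof. by rewrite /label ltnNge leq_addr addKn. Qed.

Lemma label_good j (rail rung : nat -> bool) :
  (forall i k, i = k \/ i = k + N -> i.+1 < N.*2 -> k < N -> k <> j ->
     rail i + rail i.+1 + rung k = 1) ->
  good j (label rail rung).
Proof.
move=> H x y z /lineP[k [xk -> yN kN ->]] kj.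
rewrite label_rung !label_rail //; last lia.
by apply: H => // kj'; apply: kj; rewrite kj'.
Qed.

(** A labelling that takes different values on opposite rails, as [N] is odd. *)
Definition parity_label (beta : bool) : nat -> bool :=
  label (fun i => odd i == beta) (fun=> false).

Lemma parity_good j beta : good j (parity_label beta).
Proof. by apply: label_good => i k _ _ _ _ /=; case: (odd i) beta => [] []. Qed.

Hypotheses (N_odd : odd N) (N3 : 2 < N).

(** The opposite rails [i] and [i + N], which have the same residue, lie on lines
    through the same rung. *)
Definition residue (i : nat) : nat := if i < N then i else i - N.

(** A labelling that takes the same value on opposite rails: 1 on the rails [p] and
    [p + N] only, hence 0 exactly on the rungs of the lines through these. *)
Definition single_label (p : nat) : nat -> bool :=
  label (fun i => residue i == p)
        (fun k => (k != p) && (residue k.+1 != p)).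

Lemma single_good j p : p < N -> good j (single_label p).
Proof.
move=> pN; apply: label_good => i k ik iN kN _.
have -> : residue i = k by rewrite /residue; case: ik => ->; case: ltnP; lia.
have -> : residue i.+1 = residue k.+1.
  by case: ik iN => -> // iN; rewrite /residue; case: ltnP; case: ltnP; lia.
have : k != residue k.+1 by rewrite /residue; case: ltnP; lia.
case: (eqVneq k p) => [->|_]; first by rewrite eq_sym => /negbTE->.
by case: (residue k.+1 == p).
Qed.

(** Opposite rails have different values up to the cut and the value 0 after it.
    The missing triple gets the sum 0, which is impossible without a cut. *)
Definition cut_label (j : nat) : nat -> bool :=
  label (fun i => odd i && ((i <= j) || (N <= i <= N + j)))
        (fun k => j < k < N.-1).

Lemma cut_good j : j < N.-1 -> good j (cut_label j).
Proof.
move=> jN; apply: label_good => i k ik iN kN kj.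
pose near i := (i <= j) || (N <= i <= N + j).
rewrite -/(near i) -/(near i.+1); have [k_lt|k_ge] := ltnP k j.
  have -> : (j < k < N.-1) = false by lia.
  have -> : near i by rewrite /near; lia.
  have -> : near i.+1 by rewrite /near; lia.
  by rewrite /=; case: (odd i).
have {k_ge kj} jk : j < k by lia.
have -> : near i = false by rewrite /near; lia.
rewrite jk andbF; have [kl|kl] := ltnP k N.-1.
  have -> : near i.+1 = false by rewrite /near; lia.
  by rewrite andbF.
have iE : i = N.-1 by lia.
have -> : near i.+1 by rewrite /near; lia.
by rewrite iE prednK ?N_odd //; lia.
Qed.

Lemma residueP i : i < N.*2 -> residue i < N /\ (i = residue i \/ i = residue i + N).
Proof. by move=> iN; rewrite /residue; case: (ltnP i N) => h; split; lia. Qed.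

Lemma good_separates_points j x y :
  x < N * 3 -> y < N * 3 -> x != y -> exists2 e, good j e & e x != e y.
Proof.
have par b : good j (parity_label b) := @parity_good j b.
have rail_rung u v : u < N.*2 -> N.*2 <= v ->
    exists2 e, good j e & e u != e v.
  move=> uN Nv; exists (parity_label (odd u)) => //.
  by rewrite /parity_label /label uN ltnNge Nv /= eqxx.
move=> xN yN xy; have [x2|x2] := ltnP x N.*2; have [y2|y2] := ltnP y N.*2.
- have [oxy|oxy] := eqVneq (odd x) (odd y); last first.
    exists (parity_label (odd x)) => //.
    by rewrite /parity_label !label_rail // eqxx [odd y == _]eq_sym (negbTE oxy).
  have [[rx Ex] [ry Ey]] := (residueP x2, residueP y2).
  exists (single_label (residue x)); first exact: single_good.
  have ryx : residue y != residue x by apply/eqP => rr; move/eqP: xy; lia.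
  by rewrite /single_label !label_rail // eqxx (negbTE ryx).
- exact: rail_rung.
- by have [e ge exy] := rail_rung _ _ y2 x2; exists e; rewrite // eq_sym.
have [k kN xk] : exists2 k, k < N & x = N.*2 + k by exists (x - N.*2); lia.
have [l lN yl] : exists2 l, l < N & y = N.*2 + l by exists (y - N.*2); lia.
have kl : k != l by move: xy; rewrite xk yl eqn_add2l.
have [rk Ek] : residue k.+1 < N /\ residue (residue k.+1).+1 != k.
  rewrite /residue; case: (ltnP k.+1 N) => k1; last by rewrite ifT; lia.
  by split=> //; case: (ltnP k.+2 N) => k2; lia.
have [lk|lk] := eqVneq (residue l.+1) k.
  exists (single_label (residue k.+1)); first exact: single_good.
  rewrite /single_label xk yl !label_rung eqxx andbF lk.
  have -> : l != residue k.+1.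
    by move: Ek; rewrite -lk; apply: contraNneq => <-; rewrite lk.
  by rewrite /residue; case: ltnP; lia.
exists (single_label k); first exact: single_good.
by rewrite /single_label xk yl !label_rung eqxx [l == k]eq_sym kl lk.
Qed.

(** A rung and two rails of different parities have the sum one under both parity
    labellings.  The single labellings for [k] and for the residue of [k + 1] give
    the rung the value 0; one of them separates unless the two rails have these
    residues.  By their parities, the rails are then neighbours around the ladder,
    so that the three points form a line or the missing triple. *)
Lemma good_separates_rung j x y k :
  j < N -> k < N -> k <> j -> x < N.*2 -> y < N.*2 -> odd x != odd y ->
  ~~ triple x y (N.*2 + k) ->
  exists2 e, good j e & e x + e y + e (N.*2 + k) \in [:: 0; 2].
Proof.
move=> jN kN kj.
wlog xk : x y / residue x = k => [H|] xN yN xy ntr.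
  have [xk|xk] := eqVneq (residue x) k; first exact: H.
  have [yk|yk] := eqVneq (residue y) k.
    have [||e ge exy] := H y x yk yN xN; [by rewrite eq_sym|by rewrite triple_swap|].
    by exists e => //; rewrite (addnC (e x)).
  exists (single_label k); first exact: single_good.
  by rewrite /single_label label_rung !label_rail // (negbTE xk) (negbTE yk) eqxx.
have [rx Ex] := residueP xN; rewrite xk in rx Ex.
pose k' := residue k.+1.
have k'E : k' = if k.+1 < N then k.+1 else 0.
  by rewrite /k' /residue; case: (ltnP k.+1 N); lia.
have k'N : k' < N by rewrite k'E; case: ifP; lia.
have [yk'|yk'] := eqVneq (residue y) k'; last first.
  exists (single_label k'); first exact: single_good.
  rewrite /single_label label_rung !label_rail // xk (negbTE yk') eqxx andbF.
  by have -> : (k == k') = false by rewrite k'E; case: (ltnP k.+1 N); lia.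
have [ry Ey] := residueP yN; rewrite yk' in ry Ey.
have [x0 y0 kl] : [/\ x = N.*2.-1, y = 0 & k = N.-1].
  have nl : ~~ line x y (N.*2 + k) /\ ~~ line y x (N.*2 + k).
    by move: ntr; rewrite /triple !negb_or => /and3P[-> ->].
  case: nl => /lineP nl1 /lineP nl2.
  have [kl|kl] := ltnP k.+1 N.
    rewrite kl in k'E.
    by case: nl1; exists k; split=> //; move: xy; case: Ex Ey => -> [] ->; lia.
  rewrite ltnNge kl /= in k'E.
  have [xl|xl] := eqVneq x N.-1; last by split; lia.
  by case: nl1; exists k; split=> //; lia.
exists (cut_label j); first by apply: cut_good; lia.
rewrite /cut_label label_rung !label_rail // y0 /= x0.
have -> : (N.*2.-1 <= j) || (N <= N.*2.-1 <= N + j) = false by lia.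
by rewrite andbF; have -> : (j < k < N.-1) = false by lia.
Qed.

End Ladder.

(** A parity labelling gives the sum 0 or 2 to three points unless they are a rung
    and two rails of different parities. *)
Lemma good_separates_triple N j x y z :
  odd N -> 2 < N -> j < N -> x < N * 3 -> y < N * 3 -> z < N * 3 ->
  x <> N.*2 + j -> y <> N.*2 + j -> z <> N.*2 + j -> ~~ triple N x y z ->
  exists2 e, good N j e & e x + e y + e z \in [:: 0; 2].
Proof.
move=> N_odd N3 jN xN yN zN xj yj zj ntr.
pose s b := parity_label N b x + parity_label N b y + parity_label N b z.
have par b : good N j (parity_label N b) by apply: parity_good.
have [s1|s1] := boolP (s true \in [:: 0; 2]); first by exists (parity_label N true).
have [s2|s2] := boolP (s false \in [:: 0; 2]); first by exists (parity_label N false).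
have rung u : N.*2 <= u -> u < N * 3 -> u <> N.*2 + j ->
    exists k, [/\ u = N.*2 + k, k < N & k <> j].
  by move=> Nu uN uj; exists (u - N.*2); split; lia.
have parE b u : parity_label N b u = (u < N.*2) && (odd u == b).
  by rewrite /parity_label /label; case: ifP.
have : [\/ [/\ x < N.*2, y < N.*2, N.*2 <= z & odd x != odd y],
           [/\ x < N.*2, z < N.*2, N.*2 <= y & odd x != odd z] |
           [/\ y < N.*2, z < N.*2, N.*2 <= x & odd y != odd z]].
  move: s1 s2; rewrite !inE /s !parE.
  case: (ltnP x N.*2) => hx; case: (ltnP y N.*2) => hy; case: (ltnP z N.*2) => hz;
  case: (odd x) => /=; case: (odd y) => /=; case: (odd z) => //= _ _;
  by [constructor 1|constructor 2|constructor 3].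
case=> -[h1 h2 h3 o].
- have [k [zk kN kj]] := rung z h3 zN zj; rewrite zk in ntr *.
  exact: good_separates_rung.
- have [k [yk kN kj]] := rung y h3 yN yj; rewrite yk in ntr *.
  have [|e ge] := @good_separates_rung N N_odd N3 j x z k jN kN kj h1 h2 o.
    by rewrite triple_rot triple_swap -triple_rot.
  by exists e => //; rewrite addnAC.
- have [k [xk kN kj]] := rung x h3 xN xj; rewrite xk in ntr *.
  have [|e ge] := @good_separates_rung N N_odd N3 j y z k jN kN kj h1 h2 o.
    by rewrite -triple_rot.
  by exists e => //; rewrite -addnA addnC.
Qed.

(** * The flat algebra of the ladder *)

Section LadderAlgebra.
Variable N : nat.
Hypotheses (N_odd : odd N) (N3 : 2 < N).

Local Notation point := 'I_(N * 3).

(** Besides [None], the elements are the points, a complement for each point,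
    and a top element.  The product of two points of a triple is the complement
    of the third one, and the product of a point and its complement is the top. *)
Local Notation ladder_elt := (point + option point)%type.

Local Notation pt x := (Some (inl x) : option ladder_elt).
Local Notation co x := (Some (inr (Some x)) : option ladder_elt).
Local Notation top := (Some (inr None) : option ladder_elt).

Definition third (x y : point) : option point := [pick z : point | triple N x y z].

Definition lmul (s t : option ladder_elt) : option ladder_elt :=
  match s, t with
  | Some (inl x), Some (inl y) => omap (fun z => inr (Some z)) (third x y)
  | Some (inl x), Some (inr (Some y))
  | Some (inr (Some x)), Some (inl y) => if x == y then top else None
  | _, _ => None
  end.

Lemma thirdE (x y z : point) : (third x y == Some z) = triple N x y z.
Proof.
rewrite /third; case: pickP => [w tw|nt]; last by rewrite nt.
apply/eqP/idP => [[<-]//|tz]; congr Some; apply: ord_inj.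
exact: triple_fun tw tz.
Qed.

Lemma thirdC x y : third x y = third y x.
Proof. by rewrite /third; apply: eq_pick => z; rewrite triple_swap. Qed.

Lemma lmulN s : lmul None s = None.
Proof. by []. Qed.

Lemma lmulC : commutative lmul.
Proof.
move=> [[x|[x|]]|] [[y|[y|]]|] //=; by rewrite 1?thirdC 1?eq_sym.
Qed.

Lemma lmul_triple (x y z : point) :
  lmul (lmul (pt x) (pt y)) (pt z) = if triple N x y z then top else None.
Proof.
by rewrite -thirdE /=; case: (third x y).
Qed.

Lemma lmulA : associative lmul.
Proof.
move=> [[x|[x|]]|] [[y|[y|]]|] [[z|[z|]]|] //; last first.
all: try by move=> /=; do ?[case: (third _ _) => [?|] /=]; do ?case: ifP.
by rewrite lmulC !lmul_triple -triple_rot.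
Qed.

Lemma lmulI s t u : lmul s t = lmul s u -> lmul s t <> None -> t = u.
Proof.
case: s t u => [[x|[x|]]|] [[y|[y|]]|] [[z|[z|]]|] //=; try by case: ifP.
- have := thirdE x y; have := thirdE x z.
  case: (third x y) => //= a; case: (third x z) => //= c tz ty [ac] _.
  have xya : triple N x y a by rewrite -ty.
  have xza : triple N x z a by rewrite -tz ac.
  congr (Some (inl _)); apply: ord_inj.
  by apply: (@triple_fun N a x); rewrite triple_rot.
- by case: (third x y) => //= a; case: ifP.
- by case: (third x z) => //= a; case: ifP.
- by case: eqP => [->|//]; case: eqP => [->|].
- by case: eqP => [->|//]; case: eqP => [->|].
Qed.

Definition ladder_algebra : algebra := flat lmul.

Lemma ladder_finite : finite_algebra ladder_algebra.
Proof. by exists (option ladder_elt), id; exists id. Qed.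

Lemma ladder_ai : ai_semiring ladder_algebra.
Proof. exact: flat_ai lmulA lmulC lmulN lmulI. Qed.

Section Labels.
Variables (m j : nat).
Hypotheses (m3 : 2 < m) (jN : j < N).
Implicit Types (s t b : ladder_algebra) (w : word ladder_algebra).

(** As in [Adeg], the degree of [None] exceeds [m]. *)
Definition ldeg s : nat :=
  match s with
  | Some (inl _) => 1
  | Some (inr (Some _)) => 2
  | Some (inr None) => 3
  | None => m.+1
  end.

(** The labels of a point and its complement have the sum one, the label of the
    top; so a triple of sum one makes the labelling additive on its products. *)
Definition llab (e : nat -> bool) s : bool :=
  match s with
  | Some (inl x) => e x
  | Some (inr (Some x)) => ~~ e x
  | Some (inr None) => true
  | None => false
  end.

Definition safe s : bool :=
  match s with
  | Some (inl x) | Some (inr (Some x)) => x != N.*2 + j :> nat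
  | _ => true
  end.

Lemma ldeg_gt0 s : 0 < ldeg s.
Proof. by case: s => [[|[]]|]. Qed.

Lemma ldeg_mul s t : s ⊗ t <> None -> ldeg (s ⊗ t) = ldeg s + ldeg t.
Proof.
case: s t => [[x|[x|]]|] [[y|[y|]]|] //=; try by case: eqP.
by case: (third x y).
Qed.

Lemma wprod_ldeg w : wprod w <> None -> \sum_(s <- letters w) ldeg s = ldeg (wprod w).
Proof.
case: w => s l; rewrite /wprod /letters /=.
elim/last_ind: l => [|l t IH] /=; first by rewrite big_seq1.
rewrite foldl_rcons -rcons_cons -cats1 big_cat big_seq1 /= => st0.
rewrite [RHS]ldeg_mul // IH // => s0; apply: st0; by rewrite s0.
Qed.

(** The shapes of the words of degree at most three, among which are all words
    with a value other than [None]. *)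
Variant low_word : word ladder_algebra -> Prop :=
| LowLetter s of s <> None : low_word (s, [::])
| LowPointPoint (x y : point) : low_word (pt x, [:: pt y])
| LowPointCo (x y : point) : low_word (pt x, [:: co y])
| LowCoPoint (x y : point) : low_word (co x, [:: pt y])
| LowPoints (x y z : point) : low_word (pt x, [:: pt y; pt z]).

Lemma low_wordP w : \sum_(s <- letters w) ldeg s <= 3 -> low_word w.
Proof.
case: w => s [|t [|u [|q l]]]; rewrite /letters /= !big_cons ?big_nil ?addn0.
- by move=> s3; constructor=> s0; move: s3; rewrite s0 /=; lia.
- by case: s t => [[x|[x|]]|] [[y|[y|]]|] //=; try lia; constructor.
- by case: s t u => [[x|[x|]]|] [[y|[y|]]|] [[z|[z|]]|] //=; try lia; constructor.
- move: (ldeg_gt0 s) (ldeg_gt0 t) (ldeg_gt0 u) (ldeg_gt0 q).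
  by move: (bigop _ _ _) => p; lia.
Qed.

Lemma ldeg_le3 b : b <> None -> ldeg b <= 3.
Proof. by case: b => [[|[]]|]. Qed.

Lemma lmul_co (x y z : point) :
  (pt x : ladder_algebra) ⊗ pt y = co z <-> triple N x y z.
Proof.
rewrite -thirdE /=; case: (third x y) => //= a.
by split=> [[->]|/eqP[->]].
Qed.

(** A good labelling is compatible with the products whose factors and value do
    not involve the rung [2N + j]. *)
Lemma llab_wprod e w b :
  good N j e -> b <> None -> all safe (letters w) -> safe b -> wprod w = b ->
  \sum_(s <- letters w) llab e s = llab e b.
Proof.
move=> ge b0 sw sb wE; have lw : low_word w.
  by apply: low_wordP; rewrite wprod_ldeg wE //; apply: ldeg_le3.
case: lw sw wE => [s s0|x y|x y|x y|x y z] + wE;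
  rewrite /letters /= !big_cons ?big_nil ?addn0 => sw.
- by rewrite -wE.
- case: b b0 sb wE => [[?|[z|]]|] // _; rewrite /wprod /=;
    try by case: (third x y).
  move=> /eqP zj /lmul_co t; have /and3P[/eqP xj /eqP yj _] := sw.
  by have := good_triple ge xj yj zj t; rewrite /=; do 3!case: (e _).
- by move: wE b0; rewrite /wprod /=; case: eqP => [->|_] <- // _; case: (e _).
- by move: wE b0; rewrite /wprod /=; case: eqP => [->|_] <- // _; case: (e _).
- have /and4P[/eqP xj /eqP yj /eqP zj _] := sw.
  move: wE b0; rewrite /wprod -[foldl _ _ _]/(lmul (lmul (pt x) (pt y)) (pt z)).
  rewrite lmul_triple; case: ifP => [t|_] <- // _.
  by have := good_triple ge xj yj zj t; rewrite /=; do 3!case: (e _).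
Qed.

(** Conversely, a word of the degree of [b] whose value is not [b] violates, for
    some good labelling, the equation that [llab_wprod] would give; the two sides
    then differ by exactly one, hence in every nontrivial cyclic group as well. *)
Lemma llab_separates w b :
  b <> None -> all safe (letters w) -> safe b ->
  \sum_(s <- letters w) ldeg s = ldeg b -> wprod w <> b ->
  exists2 e, good N j e &
    \sum_(s <- letters w) llab e s = (llab e b).+1 \/
    (\sum_(s <- letters w) llab e s).+1 = llab e b.
Proof.
move=> b0 sw sb dw; have lw : low_word w.
  by apply: low_wordP; rewrite dw; apply: ldeg_le3.
have points (x y : point) : x <> y -> exists2 e, good N j e & e x != e y.
  move=> xy; apply: (@good_separates_points N N_odd N3 j) => //.
  by apply/eqP => /ord_inj.
have sumP (e1 e2 e3 : bool) : e1 + e2 + e3 \in [:: 0; 2] ->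
    e1 + e2 = (~~ e3).+1 \/ (e1 + e2).+1 = ~~ e3.
  by case: e1 e2 e3 => [] [] []; rewrite !inE //= => _; [left|left|left|right].
case: lw sw dw => [s s0|x y|x y|x y|x y z] +;
  rewrite /letters /= !big_cons ?big_nil ?addn0 /wprod => sw.
- case: s b s0 b0 sw sb => [[x|[x|]]|] [[y|[y|]]|] //= _ _ _ _ _ xy.
    have [|e ge exy] := points x y; first by move=> E; rewrite E in xy.
    exists e; rewrite // !big_cons ?big_nil ?addn0 /=.
    by move: exy; case: (e x) (e y) => [] [] // _; [left|right].
  have [|e ge exy] := points x y; first by move=> E; rewrite E in xy.
  exists e; rewrite // !big_cons ?big_nil ?addn0 /=.
  by move: exy; case: (e x) (e y) => [] [] // _; [right|left].
- case: b b0 sb => [[?|[z|]]|] //= _ /eqP zj dw xyz.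
  have /and3P[/eqP xj /eqP yj _] := sw.
  have [|e ge es] := good_separates_triple N_odd N3 jN (ltn_ord x) (ltn_ord y)
      (ltn_ord z) xj yj zj; first by apply/negP => /lmul_co.
  by exists e; rewrite // !big_cons ?big_nil ?addn0 /=; apply: sumP.
- case: b b0 sb => [[?|[z|]]|] //= _ _ dw.
  case: eqP => // xy _; have [e ge exy] := points x y xy.
  exists e; rewrite // !big_cons ?big_nil ?addn0 /=.
  by move: exy; case: (e x) (e y) => [] [] // _; [left|right].
- case: b b0 sb => [[?|[z|]]|] //= _ _ dw.
  case: eqP => // xy _; have [e ge exy] := points x y xy.
  exists e; rewrite // !big_cons ?big_nil ?addn0 /=.
  by move: exy; case: (e x) (e y) => [] [] // _; [right|left].
- case: b b0 sb => [[?|[?|]]|] //= _ _ dw.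
  rewrite -[_ (third x y)]/(lmul (pt x) (pt y)) => xyz.
  have /and4P[/eqP xj /eqP yj /eqP zj _] := sw.
  have [|e ge es] := good_separates_triple N_odd N3 jN (ltn_ord x) (ltn_ord y)
      (ltn_ord z) xj yj zj.
    by apply/negP => t; apply: xyz; have := lmul_triple x y z; rewrite t.
  exists e; rewrite // !big_cons ?big_nil ?addn0 /=.
  move: es; rewrite !inE; case: (e x) (e y) (e z) => [] [] [] //= _;
    by [left|right].
Qed.

End Labels.

Definition points (s : ladder_algebra) : seq nat :=
  match s with
  | Some (inl x) | Some (inr (Some x)) => [:: nat_of_ord x]
  | _ => [::]
  end.

Lemma safeE j s : safe j s = (N.*2 + j \notin points s).
Proof.
by case: s => [[x|[x|]]|] //=; rewrite inE eq_sym.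
Qed.

Lemma exists_fresh (s : seq nat) : size s < N -> exists2 j, j < N & N.*2 + j \notin s.
Proof.
move=> sN; apply: contrapT => nj.
have sub : {subset iota N.*2 N <= s}.
  move=> x; rewrite mem_iota => xN; apply: contraT => xs.
  by case: nj; exists (x - N.*2); [lia|rewrite subnKC //; lia].
by have := uniq_leq_size (iota_uniq _ _) sub; rewrite size_iota leqNgt sN.
Qed.

(** An identity in fewer than [N - 1] variables involves fewer than [N] points
    of the ladder under any valuation, so that some rung [2N + j] is free and
    good labellings for this [j] yield the gradings that refute the identity in
    A_{m,n} if it fails in the ladder algebra.  A word of the wrong degree is
    separated by the degree alone.  For a word of the right degree, the label is
    used as group component when n > 1, and is added to the degree when n = 1;
    the top then has degree four. *)
Lemma ladder_identities m n r (e : identity) :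
  2 < m -> 0 < n -> (m, n) <> (3, 1) -> r.+1 < N -> nvars e <= r ->
  satisfies (Aalg m n) e -> satisfies ladder_algebra e.
Proof.
move=> m3 n0 mn rN er Ae v; apply: (satisfies_of_separated _ Ae).
  exact: ladder_ai.
move=> b w we wb; have b0 : b <> None.
  by move=> bN; apply: wb; rewrite bN /le flat_addE; case: eqP.
pose V := undup (vars (lhs e) ++ vars (rhs e)).
pose ps := flatten [seq points (v i) | i <- V] ++ points b.
have points1 s : size (points s) <= 1 by case: s => [[x|[x|]]|].
have ps_size : size ps < N.
  rewrite size_cat; have : size (flatten [seq points (v i) | i <- V]) <= r.
    apply: leq_trans er; rewrite /nvars -/V.
    elim: (V) => //= i l IH; rewrite size_cat.
    by apply: leq_trans (leq_add (points1 _) IH) _.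
  by have := points1 b; lia.
have [j jN jps] := exists_fresh ps_size.
have b_safe : safe j b.
  by rewrite safeE; apply: contra jps; rewrite mem_cat orbC => ->.
have w_safe (l : word nat) : {subset letters l <= vars (lhs e) ++ vars (rhs e)} ->
    all (safe j) (letters (wmap v l)).
  move=> le; rewrite -[letters _]/(map v (letters l)) all_map; apply/allP => i il.
  rewrite /= safeE; apply: contra jps => ij; rewrite mem_cat; apply/orP; left.
  apply/flattenP; exists (points (v i)) => //; apply: map_f.
  by rewrite mem_undup; apply: le.
have le_b l : wprod (wmap v l) ⊑ b -> wprod (wmap v l) = b.
  by move=> lb; apply: flat_le lb b0.
have sum_wmap (f : ladder_algebra -> nat) (l : word nat) :
    \sum_(s <- letters (wmap v l)) f s = \sum_(i <- letters l) f (v i).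
  by rewrite -[letters _]/(map v (letters l)) big_map.
have [dw|dw] := eqVneq (\sum_(s <- letters (wmap v w)) ldeg m s) (ldeg m b); last first.
  exists (fun i => ldeg m (v i)), (fun=> 0%R), (ldeg m b), 0%R; split.
  - by move=> i; apply: ldeg_gt0.
  - by rewrite ldeg_gt0 (leq_trans (ldeg_le3 m b0)).
  - move=> l [_ /le_b lb]; split; last exact: big1.
    by rewrite -sum_wmap wprod_ldeg lb.
  - by rewrite -sum_wmap => -[/eqP]; rewrite (negbTE dw).
have [|lab lab_good labw] := llab_separates m3 jN b0 (w_safe _ we) b_safe dw.
  by move=> wE; apply: wb; rewrite wE /le flat_addE eqxx.
pose delta := (n == 1) : nat.
have [c c0] : exists c : Zmod n, n = 1 \/ c != 0%R.
  have [n1|n1] := eqVneq n 1; first by exists 0%R; left.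
  have [|c cE] := @Zmod_exists n n0 1; first lia.
  by exists c; right; rewrite Zmod_neq cE.
exists (fun i => ldeg m (v i) + delta * llab lab (v i)).
exists (fun i => c *+ llab lab (v i))%R.
exists (ldeg m b + delta * llab lab b), (c *+ llab lab b)%R; split.
- by move=> i; rewrite addn_gt0 ldeg_gt0.
- rewrite addn_gt0 ldeg_gt0 /=.
  have : ldeg m b + llab lab b <= 4 by case: (b) b0 => [[x|[x|]]|] //= _; case: (lab x).
  have := ldeg_le3 m b0; rewrite /delta; case: eqP => n1 /=; last lia.
  have : m <> 3 by move=> m3'; apply: mn; rewrite m3' n1.
  lia.
- move=> l [le lb]; rewrite big_split -big_distrr GRing.sumrMnr /=.
  rewrite -(sum_wmap (ldeg m)) -!(sum_wmap (fun s => llab lab s)).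
  rewrite wprod_ldeg ?(le_b _ lb) //.
  by rewrite (llab_wprod m3 jN lab_good b0 (w_safe _ le) b_safe (le_b _ lb)).
- rewrite big_split -big_distrr GRing.sumrMnr /=.
  rewrite -(sum_wmap (ldeg m)) -!(sum_wmap (fun s => llab lab s)) dw.
  case=> /addnI; rewrite /delta; case: eqP => [_|n1].
    by rewrite !mul1n => E; move: labw; rewrite E; case; lia.
  have {}c0 : c != 0%R by case: c0 => // /n1.
  move=> _; case: labw => [->|<-]; rewrite GRing.mulrS.
    by rewrite -[RHS]GRing.add0r => /GRing.addIr /eqP; apply/negP.
  by rewrite -[LHS]GRing.add0r => /GRing.addIr /esym /eqP; apply/negP.
Qed.

End LadderAlgebra.

(** * The identity of the ladder *)

Section LadderIdentity.
Variable N : nat.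
Hypotheses (N_odd : odd N) (N3 : 2 < N).

Definition rung (i : nat) : nat := if i < N then N.*2 + i else N + i.

Definition line_term (i : nat) : term :=
  Mul (Mul (Var i) (Var i.+1)) (Var (rung i)).

Definition lines_term : term :=
  foldr (fun i t => Add (line_term i) t) (line_term 0) (iota 0 N.*2.-1).

Definition missing_term : term :=
  Mul (Mul (Var N.*2.-1) (Var 0)) (Var (N * 3).-1).

Definition ladder_identity : identity :=
  Identity lines_term (Add lines_term missing_term).

Lemma line_rung i : i < N.*2.-1 -> line N i i.+1 (rung i).
Proof. by rewrite /line /rung; case: ifP; lia. Qed.

Lemma missing_triple : ~~ triple N N.*2.-1 0 (N * 3).-1.
Proof. by rewrite /triple /line; lia. Qed.

(** The alternating sum of the equations of the lines, in which the two lines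
    through a rung have opposite signs because [N] is odd, is the equation of
    the missing triple.  It is computed here through the differences of opposite
    rails, which change sign at each step. *)
Lemma ladder_equation (G : zmodType) (f : nat -> G) (h : G) :
  (forall i, i < N.*2.-1 -> (f i + f i.+1 + f (rung i) = h)%R) ->
  (f N.*2.-1 + f 0 + f (N * 3).-1 = h)%R.
Proof.
move=> fh; pose D i := (f i - f (i + N))%R.
have step i : i.+1 < N -> (D i + D i.+1 = 0)%R.
  move=> iN; have [iN1 iN2] : i < N.*2.-1 /\ i + N < N.*2.-1 by lia.
  have := fh _ iN1; rewrite -(fh _ iN2).
  have -> : rung (i + N) = rung i by rewrite /rung; do 2!case: ifP; lia.
  move=> /GRing.addIr; rewrite -addSn => E.
  by rewrite /D GRing.addrACA E -GRing.opprD GRing.subrr.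
have Dodd i : i < N -> D i = (if odd i then - D 0 else D 0)%R.
  elim: i => // i IH iN; have := step i iN; rewrite IH; last exact: ltnW.
  move=> /eqP; rewrite GRing.addrC GRing.addr_eq0 => /eqP -> /=.
  by case: (odd i); rewrite ?GRing.opprK.
have DN : D N.-1 = D 0 by rewrite Dodd; [rewrite ifF //; lia|lia].
have NN : N.-1 + N = N.*2.-1 by lia.
have hN : N.-1 < N.*2.-1 by lia.
have rN : rung N.-1 = (N * 3).-1 by rewrite /rung; case: ifP; lia.
have := fh _ hN; rewrite rN prednK; last lia.
have {}DN : (f N.-1 - f N.*2.-1 = f 0 - f N)%R by rewrite -NN; apply: DN.
move=> <-; congr (_ + _)%R; move: DN => /eqP; rewrite GRing.subr_eq => /eqP ->.
by rewrite [RHS]GRing.addrAC GRing.addrNK GRing.addrC.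
Qed.

Lemma eval_lines (A : algebra) (v : nat -> A) i : ai_semiring A -> i < N.*2.-1 ->
  eval v (line_term i) ⊑ eval v lines_term.
Proof.
move=> A_ai iN; rewrite /lines_term; have : i \in iota 0 N.*2.-1 by rewrite mem_iota.
elim: (iota _ _) => //= k l IH; rewrite inE => /orP[/eqP <-|/IH il].
  exact: le_addl.
by apply: le_trans il _ => //; apply: le_addr.
Qed.

(** When the sum of the lines is not [None], all lines have its value, and
    [ladder_equation] applies to the degrees and to the group components. *)
Lemma A_ladder m n : satisfies (Aalg m n) ladder_identity.
Proof.
move=> v; rewrite -[LHS]/(eval v lines_term).
rewrite -[RHS]/(eval v lines_term ⊕ eval v missing_term).
have [->|/eqP] := eqVneq (eval v lines_term : Acarrier m n) None.
  by rewrite A_Nadd.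
set k := eval v lines_term => k0.
have lineE i : i < N.*2.-1 -> eval v (line_term i) = k.
  by move=> iN; apply: (flat_le _ k0); apply: eval_lines => //; apply: A_ai.
suff -> : eval v missing_term = k by rewrite A_add_id.
have prodE x y z : x ⊗ y ⊗ z =
    elt m (Adeg x + Adeg y + Adeg z) (Agr x + Agr y + Agr z)%R :> Aalg m n.
  rewrite -[LHS]/(wprod (x, [:: y; z])) wprod_A /letters /= !big_cons !big_nil.
  by rewrite addn0 addnA GRing.addr0 GRing.addrA.
have k_deg : 0 < Adeg k <= m.
  by apply: contrapT => /negP/(elt_none (Agr k)); rewrite -A_eltE.
have eqs i : i < N.*2.-1 ->
    Adeg (v i) + Adeg (v i.+1) + Adeg (v (rung i)) = Adeg k /\
    (Agr (v i) + Agr (v i.+1) + Agr (v (rung i)) = Agr k)%R.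
  move=> /lineE; rewrite -[eval v _]/(v i ⊗ v i.+1 ⊗ v (rung i)) prodE.
  by rewrite {1}(A_eltE k) => /esym /(elt_inj k_deg)[-> ->].
have degE := @ladder_equation int (fun i => Posz (Adeg (v i))) (Adeg k).
have grE := @ladder_equation _ (fun i => Agr (v i)) (Agr k).
rewrite -[LHS]/(v N.*2.-1 ⊗ v 0 ⊗ v (N * 3).-1) prodE [RHS]A_eltE; congr elt.
- suff /degE : forall i, i < N.*2.-1 ->
      (Posz (Adeg (v i)) + Posz (Adeg (v i.+1)) + Posz (Adeg (v (rung i))))%R
        = Posz (Adeg k).
    by rewrite -!PoszD => -[].
  by move=> i /eqs[<- _]; rewrite !PoszD.
- by apply: grE => i /eqs[].
Qed.

(** When the variables are the points themselves, all lines have the value top, and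
    the missing triple has the value [None]. *)
Lemma ladder_not_satisfied : ~ satisfies (ladder_algebra N) ladder_identity.
Proof.
pose v (i : nat) : ladder_algebra N :=
  if insub i is Some x then Some (inl x) else None.
have vE i (iN : i < N * 3) : v i = Some (inl (Ordinal iN)) by rewrite /v insubT.
have N0 : 0 < N * 3 by lia.
have triE i k l (iN : i < N * 3) (kN : k < N * 3) (lN : l < N * 3) :
    v i ⊗ v k ⊗ v l = (if triple N i k l then Some (inr None) else None).
  by rewrite !vE; apply: lmul_triple.
have lineE i : i < N.*2.-1 -> eval v (line_term i) = Some (inr None).
  move=> iN; have rN : rung i < N * 3 by rewrite /rung; case: ifP; lia.
  by rewrite [LHS]triE ?/triple ?line_rung //; lia.
have linesE : eval v lines_term = Some (inr None).
  have : {subset iota 0 N.*2.-1 <= gtn N.*2.-1} by move=> x; rewrite mem_iota.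
  rewrite /lines_term; elim: (iota _ _) => [_|k l IH kl]; first by apply: lineE; lia.
  rewrite -[LHS]/(eval v (line_term k) ⊕ eval v (foldr _ _ l)) lineE; last first.
    by apply: kl; rewrite inE eqxx.
  by rewrite IH ?flat_addE ?eqxx // => i il; apply: kl; rewrite inE il orbT.
move=> /(_ v); rewrite -[LHS]/(eval v lines_term) linesE.
rewrite -[RHS]/(eval v lines_term ⊕ eval v missing_term) linesE.
by rewrite [eval v missing_term]triE ?(negbTE missing_triple); try lia.
Qed.

End LadderIdentity.

(** * The theorem *)

(** The ladder has to be longer than [r + 1], and its length has to be odd. *)
Lemma no_basis_in_few_variables m n r :
  3 <= m -> 0 < n -> (m, n) <> (3, 1) ->
  exists B : algebra,
    [/\ finite_algebra B,
        ai_semiring B,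
        forall e : identity, nvars e <= r -> satisfies (Aalg m n) e -> satisfies B e
      & ~ in_variety (Aalg m n) B].
Proof.
move=> m3 n0 mn; pose N := r.*2 + 3.
have N_odd : odd N by rewrite /N; lia.
have N3 : 2 < N by rewrite /N; lia.
exists (ladder_algebra N); split.
- exact: ladder_finite.
- exact: ladder_ai.
- by move=> e; apply: ladder_identities => //; rewrite /N; lia.
- move=> /in_variety_satisfies/(_ (@A_ladder N N_odd N3 m n)).
  exact: ladder_not_satisfied.
Qed.

Theorem theorem1p1 :
  (forall m n : nat, 0 < m -> 0 < n ->
     (finitely_based (Aalg m n) <-> (m <= 2 \/ (m, n) = (3, 1))))
  /\ (forall n : nat, 1 <= n -> basis (of_seq basis1) (Aalg 1 n))
  /\ (forall n : nat, 1 <= n -> basis (of_seq (basis2 n)) (Aalg 2 n))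
  /\ basis (of_seq basis3) (Aalg 3 1)
  /\ (forall m n : nat, 3 <= m -> 0 < n -> (m, n) <> (3, 1) ->
      forall r : nat, 1 <= r ->
      exists B : algebra,
        [/\ finite_algebra B,
            ai_semiring B,
            forall e : identity,
              nvars e <= r -> satisfies (Aalg m n) e -> satisfies B e
          & ~ in_variety (Aalg m n) B]).
Proof.
split; last first.
  split; first by move=> n _; apply: basis1_complete.
  split; first by move=> n n0; apply: basis2_complete.
  split; first exact: basis3_complete.
  by move=> m n m3 n0 mn r _; apply: no_basis_in_few_variables.
move=> m n m0 n0; split=> [[E E_basis]|[m2|[-> ->]]]; last 2 first.
- have [->|->] : m = 1 \/ m = 2 by lia.
    by exists basis1; apply: basis1_complete.
  by exists (basis2 n); apply: basis2_complete.
- by exists basis3; apply: basis3_complete.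
have [m2|m3] := leqP m 2; first by left.
(* The sum bounds the number of variables of each identity of the basis. *)
right; apply: contrapT => mn.
have [B [_ _ B_sat]] := @no_basis_in_few_variables m n (\sum_(e <- E) nvars e) m3 n0 mn.
apply; apply/E_basis => e Ee; apply: B_sat; last first.
  by apply: (E_basis (Aalg m n)).2 Ee => K _.
elim: E Ee {E_basis} => //= e' E IH; rewrite big_cons => -[->|/IH].
  exact: leq_addr.
by move/leq_trans; apply; apply: leq_addl.
Qed.
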